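(* Assume $\mathsf{MA}(\sigma\text{-centered})$. Then there exists a zero-dimensional separable metrizable space $X$ such that $X$ is countable dense homogeneous while $X^2$ is not countable dense homogeneous.
   Context: All spaces are separable metrizable. For a space $X$, $\mathcal{H}(X)$ denotes the group of homeomorphisms of $X$. A space $X$ is countable dense homogeneous ($\mathsf{CDH}$) if for every pair $(A,B)$ of countable dense subsets of $X$ there exists $h\in\mathcal{H}(X)$ with $h[A]=B$. $\mathsf{MA}(\sigma\text{-centered})$ is Martin's Axiom restricted to $\sigma$-centered posets: for every $\sigma$-centered poset $\mathbb{P}$ and every family $\mathcal{D}$ of fewer than $\mathfrak{c}$ dense subsets of $\mathbb{P}$ there is a filter meeting every member of $\mathcal{D}$. *)

(* Defs.v *)
From Stdlib Require Import Reals List.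
Open Scope R_scope.

Definition topology (X : Type) := (X -> Prop) -> Prop.

Definition is_topology {X : Type} (T : topology X) : Prop :=
  T (fun _ => True) /\
  (forall U V, T U -> T V -> T (fun x => U x /\ V x)) /\
  (forall F : (X -> Prop) -> Prop, (forall U, F U -> T U) ->
     T (fun x => exists U, F U /\ U x)).

Definition is_metric {X : Type} (d : X -> X -> R) : Prop :=
  (forall x y, 0 <= d x y) /\
  (forall x y, d x y = 0 <-> x = y) /\
  (forall x y, d x y = d y x) /\
  (forall x y z, d x z <= d x y + d y z).

Definition metric_induces {X : Type} (T : topology X) (d : X -> X -> R) : Prop :=
  is_metric d /\
  forall U : X -> Prop,
    T U <-> (forall x, U x -> exists eps, 0 < eps /\ forall y, d x y < eps -> U y).

Definition metrizable {X : Type} (T : topology X) : Prop :=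
  exists d, metric_induces T d.

Definition countable_set {X : Type} (A : X -> Prop) : Prop :=
  exists f : nat -> X, forall x, A x -> exists n, f n = x.

Definition dense {X : Type} (T : topology X) (A : X -> Prop) : Prop :=
  forall U, T U -> (exists x, U x) -> exists x, U x /\ A x.

Definition separable {X : Type} (T : topology X) : Prop :=
  exists A, countable_set A /\ dense T A.

Definition clopen {X : Type} (T : topology X) (U : X -> Prop) : Prop :=
  T U /\ T (fun x => ~ U x).

Definition zero_dimensional {X : Type} (T : topology X) : Prop :=
  forall U x, T U -> U x -> exists V, clopen T V /\ V x /\ (forall y, V y -> U y).

Definition continuous {X Y : Type} (TX : topology X) (TY : topology Y)
  (f : X -> Y) : Prop :=
  forall V, TY V -> TX (fun x => V (f x)).

Definition homeomorphism {X : Type} (T : topology X) (h : X -> X) : Prop :=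
  continuous T T h /\
  exists g : X -> X, continuous T T g /\
    (forall x, g (h x) = x) /\ (forall y, h (g y) = y).

Definition CDH {X : Type} (T : topology X) : Prop :=
  forall A B : X -> Prop,
    countable_set A -> dense T A -> countable_set B -> dense T B ->
    exists h, homeomorphism T h /\
      (forall y, B y <-> exists x, A x /\ h x = y).

Definition product_topology {X Y : Type} (TX : topology X) (TY : topology Y)
  : topology (X * Y) :=
  fun U => forall p, U p -> exists V W, TX V /\ TY W /\ V (fst p) /\ W (snd p) /\
     (forall q, V (fst q) -> W (snd q) -> U q).

(* [le p q] means p <= q, i.e. p is stronger than (extends) q. *)
Definition is_partial_order {P : Type} (le : P -> P -> Prop) : Prop :=
  (forall p, le p p) /\
  (forall p q r, le p q -> le q r -> le p r) /\
  (forall p q, le p q -> le q p -> p = q).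

Definition centered {P : Type} (le : P -> P -> Prop) (C : P -> Prop) : Prop :=
  forall l : list P, (forall p, In p l -> C p) ->
    exists r, forall p, In p l -> le r p.

Definition sigma_centered {P : Type} (le : P -> P -> Prop) : Prop :=
  exists Cs : nat -> P -> Prop,
    (forall n, centered le (Cs n)) /\ (forall p, exists n, Cs n p).

Definition dense_in_poset {P : Type} (le : P -> P -> Prop) (D : P -> Prop) : Prop :=
  forall p, exists q, D q /\ le q p.

Definition poset_filter {P : Type} (le : P -> P -> Prop) (G : P -> Prop) : Prop :=
  (exists p, G p) /\
  (forall p q, G p -> le p q -> G q) /\
  (forall p q, G p -> G q -> exists r, G r /\ le r p /\ le r q).

Definition card_lt_continuum (I : Type) : Prop :=
  (exists f : I -> (nat -> bool), forall i j, f i = f j -> i = j) /\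
  ~ (exists g : (nat -> bool) -> I, forall a b, g a = g b -> a = b).

Definition MA_sigma_centered : Prop :=
  forall (P : Type) (le : P -> P -> Prop),
    inhabited P -> is_partial_order le -> sigma_centered le ->
    forall (I : Type) (D : I -> P -> Prop),
      card_lt_continuum I -> (forall i, dense_in_poset le (D i)) ->
      exists G, poset_filter le G /\ forall i, exists p, G p /\ D i p.

(* Main.v *)
(** Let [L] be the closure, under finite modifications, of an uncountable [<*]-increasing tower
    in [nat -> nat] with countable initial segments, together with [0]. It is a lambda-set:
    if [f] dominates a countable subset [C] of [L], then all but countably many [x] in [L]
    satisfy [f <* x], and these [x] are separated from [C] by countably many closed sets.
    The space [Y] of arrays with finitely many nonzero columns, all of them in [L], inherits
    this property, so the complement in [Y] of a countable set [A] is a countable union of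
    closed sets [F_n] of bounded width. Given countable dense sets [A] and [B] in [Y], an
    isometry of [Y] with [h[A] = B] is built by back and forth: besides single points, each step
    adds a whole set [F_n] to the domain (or its analogue for [B] to the range), and such a set
    can be copied away from [B] by writing a suitable element of [L] in an unused column.

    The space [Z] of arrays with finitely supported rows is Polish and is CDH by the same
    argument with single points only; hence the sum [X] of [Y] and [Z] is CDH. Off [Z * Z], some
    countable dense subset of [X * X] is G_delta, while another one is dense in a fibre
    [{y} * Z], hence not G_delta by Baire's theorem. As homeomorphisms of [X * X]
    preserve [Z * Z], no homeomorphism maps one onto the other. *)

From Stdlib Require Import Reals Lra Lia Arith Cantor Classical ClassicalEpsilon
  FunctionalExtensionality PropExtensionality ProofIrrelevance.
From mathcomp Require boolp classical_sets.
Require Import Defs.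
Local Open Scope nat_scope.
Set Bullet Behavior "Strict Subproofs".

(** * Choice, Zorn's lemma and extremal levels *)

Lemma choice_fun {A B : Type} (R : A -> B -> Prop) :
  (forall x, exists y, R x y) -> exists f, forall x, R x (f x).
Proof.
  intros H. exists (fun x => proj1_sig (constructive_indefinite_description _ (H x))).
  intros x. exact (proj2_sig (constructive_indefinite_description _ (H x))).
Qed.

Lemma zorn {T : Type} (R : T -> T -> Prop) :
  (forall t, R t t) -> (forall r s t, R r s -> R s t -> R r t) ->
  (forall s t, R s t -> R t s -> s = t) ->
  (forall A : T -> Prop, (forall s t, A s -> A t -> R s t \/ R t s) ->
     exists t, forall s, A s -> R s t) ->
  exists t, forall s, R t s -> s = t.
Proof.
  intros Hrefl Htrans Hanti Hchain.
  destruct (@classical_sets.Zorn T (fun s t => boolp.asbool (R s t))) as [t Ht].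
  - intros t. apply boolp.asboolT, Hrefl.
  - intros r s t Hrs Hst. apply boolp.asboolT.
    exact (Htrans r s t (boolp.asboolW Hrs) (boolp.asboolW Hst)).
  - intros s t Hst Hts. exact (Hanti s t (boolp.asboolW Hst) (boolp.asboolW Hts)).
  - intros A HA. destruct (Hchain A) as [t Ht].
    + intros s t As At. destruct (HA s t As At) as [H|H]; [left|right]; exact (boolp.asboolW H).
    + exists t. intros s As. apply boolp.asboolT, Ht, As.
  - exists t. intros s Hs. apply Ht, boolp.asboolT, Hs.
Qed.

Lemma least_failure (P : nat -> Prop) :
  P 0 -> (exists k, ~ P k) -> exists m, P m /\ ~ P (S m).
Proof.
  intros H0 [k Hk]. apply NNPP. intros Hn. apply Hk. clear Hk.
  induction k as [|k IH]; auto. apply NNPP. intros Hk. apply Hn. eauto.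
Qed.

Lemma bounded_prefix (f : nat -> nat) k : exists b, forall m, m <= k -> f m <= b.
Proof.
  induction k as [|k [b Hb]].
  - exists (f 0). intros m Hm. replace m with 0 by lia. lia.
  - exists (Nat.max b (f (S k))). intros m Hm.
    destruct (Nat.eq_dec m (S k)) as [->|Hne]; [lia|].
    specialize (Hb m ltac:(lia)). lia.
Qed.

(** * Enumerations *)

Definition pairing (c : nat) : nat * nat := Cantor.of_nat c.

Lemma pairing_surj a b : exists c, pairing c = (a, b).
Proof. exists (Cantor.to_nat (a, b)). apply Cantor.cancel_of_to. Qed.

Fixpoint digit (c i : nat) : nat :=
  match i with
  | 0 => fst (pairing c)
  | S i => digit (snd (pairing c)) i
  end.

Lemma digit_surj k : forall f : nat -> nat, exists c, forall i, i < k -> digit c i = f i.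
Proof.
  induction k as [|k IH]; intros f.
  - exists 0. lia.
  - destruct (IH (fun i => f (S i))) as [c Hc].
    destruct (pairing_surj (f 0) c) as [c' Hc'].
    exists c'. intros [|i] Hi; simpl; rewrite Hc'; simpl; auto. apply Hc. lia.
Qed.

(** * Eventual domination *)

Definition lt_star (f g : nat -> nat) := exists k, forall i, k <= i -> f i < g i.
Definition eq_star (f g : nat -> nat) := exists k, forall i, k <= i -> f i = g i.

Lemma lt_star_irrefl f : ~ lt_star f f.
Proof. intros [k Hk]. specialize (Hk k (le_n k)). lia. Qed.

Lemma lt_star_trans f g h : lt_star f g -> lt_star g h -> lt_star f h.
Proof.
  intros [k Hk] [l Hl]. exists (k + l). intros i Hi.
  specialize (Hk i ltac:(lia)). specialize (Hl i ltac:(lia)). lia.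
Qed.

Lemma eq_star_sym f g : eq_star f g -> eq_star g f.
Proof. intros [k Hk]. exists k. intros i Hi. symmetry. auto. Qed.

Lemma eq_star_trans f g h : eq_star f g -> eq_star g h -> eq_star f h.
Proof.
  intros [k Hk] [l Hl]. exists (k + l). intros i Hi.
  rewrite Hk by lia. apply Hl. lia.
Qed.

Lemma countable_dominated (c : nat -> nat -> nat) : exists f, forall n, lt_star (c n) f.
Proof.
  destruct (choice_fun (fun i b => forall n, n <= i -> c n i <= b)) as [f Hf].
  - intros i. apply (bounded_prefix (fun n => c n i)).
  - exists (fun i => S (f i)). intros n. exists n. intros i Hi. specialize (Hf i n Hi). lia.
Qed.

Lemma eq_star_countable (e : nat -> nat -> nat) :
  exists e' : nat -> nat -> nat, forall n x, eq_star x (e n) -> exists j, e' j = x.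
Proof.
  (* [j] codes the index [n], the length [k] of the modified part and a code [c] for its values. *)
  exists (fun j i => let (n, kc) := pairing j in let (k, c) := pairing kc in
                     if i <? k then digit c i else e n i).
  intros n x [k Hk]. destruct (digit_surj k x) as [c Hc].
  destruct (pairing_surj k c) as [kc Hkc]. destruct (pairing_surj n kc) as [j Hj].
  exists j. apply functional_extensionality. intros i. rewrite Hj, Hkc.
  destruct (Nat.ltb_spec i k); auto. symmetry. auto.
Qed.

(** * Uncountable towers and the family they generate *)

Definition star_tower (M : (nat -> nat) -> Prop) : Prop :=
  (forall x y, M x -> M y -> x = y \/ lt_star x y \/ lt_star y x) /\
  (forall x, M x -> exists c : nat -> nat -> nat,
     forall y, M y -> lt_star y x -> exists n, c n = y).

(** The order for Zorn's lemma. Under plain inclusion initial segments could become uncountable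
    along a chain; since new elements are placed above all old ones, the segment below an old
    element never changes. *)
Definition end_extension (M N : (nat -> nat) -> Prop) : Prop :=
  (forall x, M x -> N x) /\ (forall x y, M x -> N y -> ~ M y -> lt_star x y).

Lemma star_tower_union (F : ((nat -> nat) -> Prop) -> Prop) :
  (forall M, F M -> star_tower M) ->
  (forall M N, F M -> F N -> end_extension M N \/ end_extension N M) ->
  star_tower (fun x => exists M, F M /\ M x) /\
  forall M, F M -> end_extension M (fun x => exists M, F M /\ M x).
Proof.
  intros HF Hch. split; [split|].
  - intros x y [M [FM Mx]] [N [FN Ny]].
    destruct (Hch M N FM FN) as [[HMN _]|[HNM _]].
    + apply (HF N FN); auto.
    + apply (HF M FM); auto.
  - intros x [M [FM Mx]]. destruct (proj2 (HF M FM) x Mx) as [c Hc].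
    exists c. intros y [N [FN Ny]] Hyx. apply Hc; auto.
    apply NNPP. intros My.
    destruct (Hch M N FM FN) as [[_ HMN]|[HNM _]]; auto.
    apply (lt_star_irrefl x). eapply lt_star_trans; eauto.
  - intros M FM. split; [eauto|].
    intros x y Mx [N [FN Ny]] My.
    destruct (Hch M N FM FN) as [[_ HMN]|[HNM _]]; auto. exfalso. auto.
Qed.

(** A tower maximal for end-extension works: if a sequence exhausted it, a function dominating that
    sequence could be put on top. *)
Lemma uncountable_star_tower :
  exists M, star_tower M /\
    forall c : nat -> nat -> nat, exists x, M x /\ forall n, c n <> x.
Proof.
  destruct (zorn 
              (fun M N : {M | star_tower M} => end_extension (proj1_sig M) (proj1_sig N))) as [[M HM] Hmax].
  - intros [M HM]. split; simpl; auto. intros x y Mx My nMy. contradiction.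
  - intros [M HM] [N HN] [P HP]; simpl. intros [H1 H2] [H3 H4]. split; auto.
    intros x y Mx Py nMy. destruct (classic (N y)); auto.
  - intros [M HM] [N HN]; simpl. intros [H1 _] [H2 _].
    assert (M = N) as ->.
    { apply functional_extensionality. intros x. apply propositional_extensionality.
      split; auto. }
    f_equal. apply proof_irrelevance.
  - intros A Htot.
    set (F := fun M => exists HM : star_tower M, A (exist _ M HM)).
    destruct (star_tower_union F) as [HU HE].
    + intros M [HM _]. exact HM.
    + intros M N [HM AM] [HN AN]. exact (Htot _ _ AM AN).
    + exists (exist _ _ HU). intros [M HM] AM. apply HE. exists HM. exact AM.
  - exists M. split; auto. intros c. apply NNPP. intros Hn.
    assert (Hc : forall x, M x -> exists n, c n = x).
    { intros x Mx. apply NNPP. intros Hx. apply Hn. exists x. split; auto.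
      intros n En. apply Hx. eauto. }
    destruct (countable_dominated c) as [f Hf].
    assert (Hlt : forall x, M x -> lt_star x f).
    { intros x Mx. destruct (Hc x Mx) as [n <-]. apply Hf. }
    assert (HM' : star_tower (fun x => M x \/ x = f)).
    { split.
      - intros x y [Mx| ->] [My| ->]; auto. now apply (proj1 HM).
      - intros x Hx. exists (fun n => match n with 0 => f | S n => c n end).
        intros y [My| ->] _.
        + destruct (Hc y My) as [n En]. exists (S n). exact En.
        + exists 0. reflexivity. }
    specialize (Hmax (exist _ _ HM')). simpl in Hmax.
    assert (HE : end_extension M (fun x => M x \/ x = f)).
    { split; auto. intros x y Mx [My| ->] nMy; [contradiction|auto]. }
    specialize (Hmax HE). apply (f_equal (@proj1_sig _ _)) in Hmax. simpl in Hmax.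
    apply (lt_star_irrefl f), Hlt. rewrite <- Hmax. auto.
Qed.

(** Closure under finite modification allows arrays to be spliced at a row without leaving the
    space. [lf_lambda] is the lambda-set property in terms of domination, and [lf_large] supplies a
    column foreign to any prescribed countable set. *)
Record lambda_family (L : (nat -> nat) -> Prop) : Prop := {
  lf_zero : L (fun _ => 0);
  lf_eq_star : forall x y, L x -> eq_star y x -> L y;
  lf_lambda : forall c : nat -> nat -> nat, (forall n, L (c n)) ->
    exists f, (forall n, exists m, forall i, m <= i -> c n i <= f i) /\
      exists e : nat -> nat -> nat, forall x, L x -> lt_star f x \/ exists n, e n = x;
  lf_large : forall c : nat -> nat -> nat, exists t, L t /\ forall n, ~ eq_star t (c n)
}.

(** For [lf_lambda], replace each [c n] by its representative [r n] in the tower and choose [f] in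
    the tower outside the countably many closed initial segments below the [r n]. By linearity [f]
    dominates all of them, and what is not above [f] is a finite modification of zero, of [f] or of
    one of the countably many elements below [f]. *)
Lemma lambda_family_exists : exists L, lambda_family L.
Proof.
  destruct uncountable_star_tower as [M [[Hlin Hseg] Hunc]].
  exists (fun y => exists x, (M x \/ x = fun _ => 0) /\ eq_star y x). split.
  - exists (fun _ => 0). split; auto. exists 0. auto.
  - intros x y [z [Hz Hxz]] Hyx. exists z. split; auto. eapply eq_star_trans; eauto.
  - intros c Hc. apply choice_fun in Hc. destruct Hc as [r Hr].
    (* [s n] enumerates the closed initial segment of the tower below [r n]; its value is arbitrary
       if [r n] is not in the tower. *)
    assert (Hs : forall n, exists s : nat -> nat -> nat, forall y, M y ->
              M (r n) -> y = r n \/ lt_star y (r n) -> exists l, s l = y).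
    { intros n. destruct (classic (M (r n))) as [Mr|nMr].
      - destruct (Hseg _ Mr) as [s Hs].
        exists (fun l => match l with 0 => r n | S l => s l end).
        intros y My _ [->|Hy]; [exists 0; reflexivity|].
        destruct (Hs y My Hy) as [l El]. exists (S l). exact El.
      - exists (fun _ => r n). intros; contradiction. }
    apply choice_fun in Hs. destruct Hs as [s Hs].
    destruct (Hunc (fun k => let (n, l) := pairing k in s n l)) as [f [Mf Hf]].
    exists f. split.
    + intros n. destruct (Hr n) as [[Mr|Er] [k Hk]].
      * destruct (Hlin (r n) f Mr Mf) as [E|[[l Hl]|Hl]].
        -- exists k. intros i Hi. rewrite Hk, E by lia. lia.
        -- exists (k + l). intros i Hi. rewrite Hk by lia. specialize (Hl i ltac:(lia)). lia.
        -- exfalso. destruct (Hs n f Mf Mr (or_intror Hl)) as [l El].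
           destruct (pairing_surj n l) as [j Ej]. apply (Hf j). rewrite Ej. exact El.
      * exists k. intros i Hi. rewrite Hk by lia. rewrite Er. lia.
    + destruct (Hseg f Mf) as [u Hu].
      destruct (eq_star_countable (fun n => match n with
                  0 => f | 1 => fun _ => 0 | S (S n) => u n end)) as [e He].
      exists e. intros x [z [[Mz|Ez] Hxz]].
      * destruct (Hlin z f Mz Mf) as [E|[Hl|Hl]].
        -- right. apply (He 0). rewrite <- E. exact Hxz.
        -- right. destruct (Hu z Mz Hl) as [n En]. apply (He (S (S n))).
           rewrite En. exact Hxz.
        -- left. destruct Hl as [k Hk], Hxz as [l Hl]. exists (k + l). intros i Hi.
           rewrite Hl by lia. apply Hk. lia.
      * right. apply (He 1). rewrite <- Ez. exact Hxz.
  - intros c. destruct (eq_star_countable c) as [e He].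
    destruct (Hunc e) as [x [Mx Hx]]. exists x. split.
    + exists x. split; auto. exists 0. auto.
    + intros n Hn. destruct (He n x Hn) as [j Ej]. exact (Hx j Ej).
Qed.

(** * Partial isometries of arrays *)

(** The first index is the row. An array is viewed as a branch of a tree whose letters are whole
    rows, and its first [k] rows as a node of level [k]. *)
Definition array := nat -> nat -> nat.

Definition agree (k : nat) (x y : array) : Prop := forall r, r < k -> x r = y r.

Lemma agree_refl k x : agree k x x.
Proof. intros r _. reflexivity. Qed.

Lemma agree_sym k x y : agree k x y -> agree k y x.
Proof. intros H r Hr. symmetry. auto. Qed.

Lemma agree_trans k x y z : agree k x y -> agree k y z -> agree k x z.
Proof. intros H1 H2 r Hr. rewrite H1 by auto. auto. Qed.

Lemma agree_le k l x y : k <= l -> agree l x y -> agree k x y.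
Proof. intros Hkl H r Hr. apply H. lia. Qed.

Lemma agree_eq x y : (forall k, agree k x y) -> x = y.
Proof. intros H. apply functional_extensionality. intros r. apply (H (S r)). lia. Qed.

Lemma agree_trans_iff k x y z : agree k x y -> (agree k x z <-> agree k y z).
Proof.
  intros H. split; intros H'; eapply agree_trans; eauto. now apply agree_sym.
Qed.

Definition closed_in (P K : array -> Prop) : Prop :=
  forall x, P x -> ~ K x -> exists k, forall y, K y -> ~ agree k x y.

(* The rows that may follow a given initial segment of an element of [K] vanish
   beyond a common column, so infinitely many rows are left unused by [K]. *)
Definition thin (K : array -> Prop) : Prop :=
  forall k x, exists N, forall y, K y -> agree k x y -> forall i, N <= i -> y k i = 0.

Lemma closed_in_union P K K' :
  closed_in P K -> closed_in P K' -> closed_in P (fun x => K x \/ K' x).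
Proof.
  intros HK HK' x Sx nx. destruct (HK x Sx) as [k Hk]; [tauto|].
  destruct (HK' x Sx) as [l Hl]; [tauto|].
  exists (Nat.max k l). intros y [Ky|Ky] Hy.
  - apply (Hk y Ky). eapply agree_le; [|exact Hy]. lia.
  - apply (Hl y Ky). eapply agree_le; [|exact Hy]. lia.
Qed.

Lemma thin_union K K' : thin K -> thin K' -> thin (fun x => K x \/ K' x).
Proof.
  intros HK HK' k x. destruct (HK k x) as [N HN]. destruct (HK' k x) as [N' HN'].
  exists (Nat.max N N'). intros y [Ky|Ky] Hy i Hi.
  - apply (HN y Ky Hy). lia.
  - apply (HN' y Ky Hy). lia.
Qed.

Lemma closed_in_singleton P a : closed_in P (fun x => x = a).
Proof.
  intros x _ Hx. apply NNPP. intros Hn. apply Hx, agree_eq. intros k.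
  apply NNPP. intros Hk. apply Hn. exists k. intros y ->. exact Hk.
Qed.

(** With finitely supported rows there are only countably many letters, so these arrays form a copy
    of the Baire space. *)
Definition finite_rows (x : array) : Prop :=
  forall r, exists N, forall i, N <= i -> x r i = 0.

Lemma thin_singleton a : finite_rows a -> thin (fun x => x = a).
Proof. intros Ha k x. destruct (Ha k) as [N HN]. exists N. intros y -> _. exact HN. Qed.

(** Two arrays are equal once they agree at all levels, so such a relation is automatically
    single-valued and injective: a partial isometry given by its graph. *)
Definition isometric (H : array -> array -> Prop) : Prop :=
  forall x x' y y' k, H x x' -> H y y' -> (agree k x y <-> agree k x' y').

Definition domain (H : array -> array -> Prop) (x : array) : Prop := exists y, H x y.
Definition range (H : array -> array -> Prop) (y : array) : Prop := exists x, H x y.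
Definition converse (H : array -> array -> Prop) (x y : array) : Prop := H y x.

(** The invariant of the back and forth. Closedness makes every new point leave the domain or range
    at a definite level, and thinness keeps a row free there through which its partner can leave. *)
Record good (P A B : array -> Prop) (H : array -> array -> Prop) : Prop := {
  good_in : forall x y, H x y -> P x /\ P y /\ (A x <-> B y);
  good_isometric : isometric H;
  good_nonempty : exists x y, H x y;
  good_closed_domain : closed_in P (domain H);
  good_closed_range : closed_in P (range H);
  good_thin_domain : thin (domain H);
  good_thin_range : thin (range H)
}.

Lemma good_converse P A B H : good P A B H -> good P B A (converse H).
Proof.
  intros [Hin Hiso [a [b Hab]] H1 H2 H3 H4]. split; auto.
  - intros x y Hxy. destruct (Hin y x Hxy) as [? [? ?]]. tauto.
  - intros x x' y y' k Hx Hy. symmetry. apply Hiso; auto.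
  - exists b, a. exact Hab.
Qed.

(** The pair leaves domain and range at corresponding nodes of the same level [m]. *)
Definition branch (H : array -> array -> Prop) (m : nat) (x x' : array) : Prop :=
  (exists p p', H p p' /\ agree m x p /\ agree m x' p') /\
  (forall q, domain H q -> ~ agree (S m) x q) /\
  (forall q', range H q' -> ~ agree (S m) x' q').

(** Up to level [m] the new pair can be replaced by the pair [p], [p'] of [H]; above level [m] it
    agrees with nothing in [H] on either side. *)
Lemma branch_agree H m x x' q q' k :
  isometric H -> branch H m x x' -> H q q' -> (agree k x q <-> agree k x' q').
Proof.
  intros Hiso [[p [p' [Hp [Ha Ha']]]] [Hd Hr]] Hq.
  destruct (le_lt_dec k m) as [Hk|Hk].
  - rewrite (agree_trans_iff k x p q) by (eapply agree_le; eauto).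
    rewrite (agree_trans_iff k x' p' q') by (eapply agree_le; eauto).
    apply Hiso; auto.
  - split; intros Hag; exfalso.
    + apply (Hd q); [exists q'; auto|]. eapply agree_le; eauto.
    + apply (Hr q'); [exists q; auto|]. eapply agree_le; eauto.
Qed.

Lemma branch_level (K : array -> Prop) m m' x p q :
  (forall q, K q -> ~ agree (S m) x q) -> (forall q, K q -> ~ agree (S m') x q) ->
  K p -> K q -> agree m x p -> agree m' x q -> m = m'.
Proof.
  intros H H' Kp Kq Hp Hq. destruct (lt_eq_lt_dec m m') as [[Hl|He]|Hl]; auto; exfalso.
  - apply (H q Kq). eapply agree_le; eauto.
  - apply (H' p Kp). eapply agree_le; eauto.
Qed.

(** New pairs that leave [H] at different nodes are compared through elements of [H]. Only pairs
    leaving at the same node have to be compared directly, and that is the last hypothesis. *)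
Lemma isometric_union H G :
  isometric H ->
  (forall x x', G x x' -> exists m, branch H m x x') ->
  (forall m x x' y y', G x x' -> G y y' -> branch H m x x' -> branch H m y y' ->
     agree m x y -> forall k, agree k x y <-> agree k x' y') ->
  isometric (fun x y => H x y \/ G x y).
Proof.
  intros Hiso Hbr Hsame.
  assert (Hle : forall m m' x x' y y' k, branch H m x x' -> branch H m' y y' ->
            m <= m' -> k <= m' -> (agree k x y <-> agree k x' y')).
  { intros m m' x x' y y' k Bx By Hm Hk.
    destruct By as [[p [p' [Hp [Ha Ha']]]] _].
    assert (E : agree k x y <-> agree k x p).
    { split; intros E; eapply agree_trans; eauto using agree_le, agree_sym. }
    assert (E' : agree k x' y' <-> agree k x' p').
    { split; intros E'; eapply agree_trans; eauto using agree_le, agree_sym. }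
    rewrite E, E'. eapply branch_agree; eauto. }
  (* While [y] still follows [H] at level [m'], [x] has left it at the lower level [m], so the two
     have parted by then; likewise for the images. *)
  assert (Hgt : forall m m' x x' y y' k, branch H m x x' -> branch H m' y y' ->
            m < m' -> m' < k -> ~ agree k x y /\ ~ agree k x' y').
  { intros m m' x x' y y' k [_ [Hd Hr]] By Hm Hk.
    destruct By as [[p [p' [Hp [Ha Ha']]]] _].
    split; intros E.
    - apply (Hd p); [exists p'; auto|]. apply agree_trans with y;
        [apply (agree_le _ k)|apply (agree_le _ m')]; auto; lia.
    - apply (Hr p'); [exists p; auto|]. apply agree_trans with y';
        [apply (agree_le _ k)|apply (agree_le _ m')]; auto; lia. }
  assert (HGG : forall m m' x x' y y' k, G x x' -> G y y' -> branch H m x x' ->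
            branch H m' y y' -> m <= m' -> (agree k x y <-> agree k x' y')).
  { intros m m' x x' y y' k Gx Gy Bx By Hm.
    destruct (le_lt_dec k m') as [Hk|Hk]; [eapply Hle; eauto|].
    destruct (le_lt_eq_dec m m' Hm) as [Hlt|<-].
    - destruct (Hgt m m' x x' y y' k Bx By Hlt Hk). tauto.
    - destruct (classic (agree m x y)) as [E|E]; [eapply Hsame; eauto|].
      assert (E' : ~ agree m x' y') by (rewrite <- (Hle m m x x' y y' m); auto).
      split; intros F; exfalso; [apply E|apply E']; eapply agree_le; [|exact F| |exact F]; lia. }
  intros x x' y y' k [Hx|Gx] [Hy|Gy].
  - apply Hiso; auto.
  - destruct (Hbr y y' Gy) as [m Bm].
    assert (E := branch_agree H m y y' x x' k Hiso Bm Hx).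
    split; intros F; apply agree_sym, E, agree_sym, F.
  - destruct (Hbr x x' Gx) as [m Bm]. eapply branch_agree; eauto.
  - destruct (Hbr x x' Gx) as [m Bx]. destruct (Hbr y y' Gy) as [m' By].
    destruct (le_ge_dec m m') as [Hm|Hm]; [eapply HGG; eauto|].
    assert (E := HGG m' m y y' x x' k Gy Gx By Bx Hm).
    split; intros F; apply agree_sym, E, agree_sym, F.
Qed.

(** [m] is the last level at which [x] agrees with some point of the domain: level 0 qualifies as
    the domain is nonempty, and some level fails as it is closed. *)
Lemma branch_exists P A B H x :
  good P A B H -> P x -> ~ domain H x ->
  exists m p p', H p p' /\ agree m x p /\ forall q, domain H q -> ~ agree (S m) x q.
Proof.
  intros HG Sx nx. destruct (good_nonempty _ _ _ _ HG) as [a [b Hab]].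
  destruct (good_closed_domain _ _ _ _ HG x Sx nx) as [k Hk].
  destruct (least_failure (fun m => exists q, domain H q /\ agree m x q)) as [m [[p [[p' Hp] Hm]] Hn]].
  - exists a. split; [exists b; auto|]. intros r Hr. lia.
  - exists k. intros [q [Hq Hxq]]. exact (Hk q Hq Hxq).
  - exists m, p, p'. split; [|split]; auto. intros q Hq Hag. apply Hn. eauto.
Qed.

(** Placing a unit row at level [m] makes an array leave any given thin set there, provided [N] is
    large. *)
Definition row_extendable (P : array -> Prop) : Prop :=
  forall x m N, P x ->
    P (fun r => if r =? m then (fun i => if i =? N then 1 else 0) else x r).

Definition dense_in (P A : array -> Prop) : Prop :=
  forall x k, P x -> exists a, A a /\ agree k x a.

(** If [a] leaves the domain at the node of [p], its image should leave the range at the node of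
    [p']. A unit row with a large index [N] does so by thinness, and density of [B] provides a point
    [b] that begins in this way. *)
Lemma extend_point P A B H a :
  good P A B H -> row_extendable P -> (forall x, P x -> finite_rows x) ->
  (forall b, B b -> P b) -> dense_in P B -> P a -> A a ->
  exists H', good P A B H' /\ (forall x y, H x y -> H' x y) /\ domain H' a.
Proof.
  intros HG Hrow Hfin HBS HB Sa Aa.
  destruct (classic (domain H a)) as [Da|nDa]; [exists H; auto|].
  destruct (branch_exists _ _ _ _ _ HG Sa nDa) as [m [p [p' [Hp [Hap Hnm]]]]].
  destruct (good_thin_range _ _ _ _ HG m p') as [N HN].
  destruct (good_in _ _ _ _ HG p p' Hp) as [_ [Sp' _]].
  destruct (HB _ (S m) (Hrow p' m N Sp')) as [b [Bb Hb]].
  assert (Hbp : agree m p' b).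
  { intros r Hr. rewrite <- Hb by lia. destruct (Nat.eqb_spec r m); [lia|reflexivity]. }
  assert (Hbm : b m N = 1).
  { rewrite <- Hb by lia. now rewrite !Nat.eqb_refl. }
  assert (Hbr : branch H m a b).
  { split; [exists p, p'; auto using agree_sym|]. split; auto.
    intros q' Hq' Hag. assert (q' m N = 0).
    { apply (HN q' Hq'); [|lia]. apply agree_trans with b; auto.
      eapply agree_le; [|exact Hag]; lia. }
    rewrite <- (Hag m) in H0 by lia. lia. }
  set (G := fun x y : array => x = a /\ y = b).
  assert (ED : domain (fun x y => H x y \/ G x y) = fun x => domain H x \/ x = a).
  { apply functional_extensionality. intros x. apply propositional_extensionality.
    split.
    - intros [y [Hy|[-> _]]]; [left; exists y; auto|auto].
    - intros [[y Hy]| ->]; [exists y; auto|exists b; right; split; auto]. }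
  assert (ER : range (fun x y => H x y \/ G x y) = fun x => range H x \/ x = b).
  { apply functional_extensionality. intros y. apply propositional_extensionality.
    split.
    - intros [x [Hx|[_ ->]]]; [left; exists x; auto|auto].
    - intros [[x Hx]| ->]; [exists x; auto|exists a; right; split; auto]. }
  exists (fun x y => H x y \/ G x y). split; [|split].
  - split.
    + intros x y [Hxy|[-> ->]]; [now apply HG|]. repeat split; auto.
    + apply isometric_union.
      * apply HG.
      * intros x x' [-> ->]. eauto.
      * intros m' x x' y y' [-> ->] [-> ->] _ _ _ k. split; intros _; apply agree_refl.
    + exists p, p'. auto.
    + rewrite ED. apply closed_in_union; [apply HG|apply closed_in_singleton].
    + rewrite ER. apply closed_in_union; [apply HG|apply closed_in_singleton].
    + rewrite ED. apply thin_union; [apply HG|apply thin_singleton; auto].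
    + rewrite ER. apply thin_union; [apply HG|apply thin_singleton; auto].
  - auto.
  - rewrite ED. auto.
Qed.

Lemma good_singleton P A B a b :
  P a -> P b -> A a -> B b -> finite_rows a -> finite_rows b ->
  good P A B (fun x y => x = a /\ y = b).
Proof.
  intros Sa Sb Aa Bb Fa Fb.
  assert (ED : domain (fun x y => x = a /\ y = b) = fun x => x = a).
  { apply functional_extensionality. intros x. apply propositional_extensionality.
    split; [intros [y [E _]]; auto|intros ->; exists b; auto]. }
  assert (ER : range (fun x y => x = a /\ y = b) = fun y => y = b).
  { apply functional_extensionality. intros x. apply propositional_extensionality.
    split; [intros [y [_ E]]; auto|intros ->; exists a; auto]. }
  split.
  - intros x y [-> ->]. tauto.
  - intros x x' y y' k [-> ->] [-> ->]. split; intros _; apply agree_refl.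
  - eauto.
  - rewrite ED. apply closed_in_singleton.
  - rewrite ER. apply closed_in_singleton.
  - rewrite ED. now apply thin_singleton.
  - rewrite ER. now apply thin_singleton.
Qed.

(** Closedness and thinness serve the finite stages; the union of the stages retains isometry and
    the matching of [A] with [B]. *)
Lemma back_and_forth P A B (D R : nat -> array -> Prop) H0 :
  good P A B H0 ->
  (forall n H, good P A B H -> exists H', good P A B H' /\
     (forall x y, H x y -> H' x y) /\
     (forall x, D n x -> domain H' x) /\ (forall y, R n y -> range H' y)) ->
  exists H, isometric H /\ (forall x y, H x y -> P x /\ P y /\ (A x <-> B y)) /\
    (forall n x, D n x -> domain H x) /\ (forall n y, R n y -> range H y).
Proof.
  intros HG0 Hstep.
  (* The choice ranges over all relations, so its specification is conditional on [good]. *)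
  destruct (choice_fun (fun (nH : nat * (array -> array -> Prop)) H' =>
     good P A B (snd nH) -> good P A B H' /\ (forall x y, snd nH x y -> H' x y) /\
     (forall x, D (fst nH) x -> domain H' x) /\ (forall y, R (fst nH) y -> range H' y)))
    as [step Hs].
  { intros [n H]. destruct (classic (good P A B H)) as [HG|HG].
    - destruct (Hstep n H HG) as [H' HH']. exists H'. intros _. exact HH'.
    - exists H. simpl. intros; contradiction. }
  set (h := fix h n := match n with 0 => H0 | S n => step (n, h n) end).
  assert (Hg : forall n, good P A B (h n)).
  { induction n as [|n IH]; simpl; auto. now apply (Hs (n, h n)). }
  assert (Hmono : forall n k x y, h n x y -> h (k + n) x y).
  { intros n k x y Hxy. induction k as [|k IH]; simpl; auto.
    apply (Hs (k + n, h (k + n))); auto. apply Hg. }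
  exists (fun x y => exists n, h n x y). repeat split.
  - intros HA. destruct H as [n Hx], H1 as [l Hy].
    apply (good_isometric _ _ _ _ (Hg (l + n)) x x' y y' k); auto.
    rewrite Nat.add_comm. auto.
  - intros HA. destruct H as [n Hx], H1 as [l Hy].
    apply (good_isometric _ _ _ _ (Hg (l + n)) x x' y y' k); auto.
    rewrite Nat.add_comm. auto.
  - destruct H as [n Hn]. now apply (good_in _ _ _ _ (Hg n) x y).
  - destruct H as [n Hn]. now apply (good_in _ _ _ _ (Hg n) x y).
  - destruct H as [n Hn]. now apply (good_in _ _ _ _ (Hg n) x y).
  - destruct H as [n Hn]. now apply (good_in _ _ _ _ (Hg n) x y).
  - intros n x Dx. destruct (Hs (n, h n) (Hg n)) as [_ [_ [HD _]]].
    destruct (HD x Dx) as [y Hy]. exists y, (S n). exact Hy.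
  - intros n y Ry. destruct (Hs (n, h n) (Hg n)) as [_ [_ [_ HR]]].
    destruct (HR y Ry) as [x Hx]. exists x, (S n). exact Hx.
Qed.

(** * The meager factor *)

Definition column (i : nat) (x : array) : nat -> nat := fun r => x r i.

Definition width_le (N : nat) (x : array) : Prop := forall r i, N <= i -> x r i = 0.

Definition meager_space (L : (nat -> nat) -> Prop) (x : array) : Prop :=
  (exists N, width_le N x) /\ forall i, L (column i x).

Lemma meager_space_finite_rows L x : meager_space L x -> finite_rows x.
Proof. intros [[N HN] _] r. exists N. auto. Qed.

Lemma meager_space_row_extendable L :
  lambda_family L -> row_extendable (meager_space L).
Proof.
  intros HL x m N [[M HM] Hc]. split.
  - exists (Nat.max M (S N)). intros r i Hi. destruct (Nat.eqb_spec r m).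
    + destruct (Nat.eqb_spec i N); lia.
    + apply HM. lia.
  - intros i. apply (lf_eq_star L HL (column i x)); auto. exists (S m). intros r Hr.
    unfold column. destruct (Nat.eqb_spec r m); [lia|reflexivity].
Qed.

Lemma width_le_closed P N : closed_in P (width_le N).
Proof.
  intros x _ nx. apply not_all_ex_not in nx. destruct nx as [r nx].
  apply not_all_ex_not in nx. destruct nx as [i nx].
  exists (S r). intros y Hy Hag. apply nx. intros Hi. rewrite (Hag r) by lia. auto.
Qed.

Lemma closed_in_inter P K K' :
  closed_in P K -> closed_in P K' -> closed_in P (fun x => K x /\ K' x).
Proof.
  intros HK HK' x Px nx. destruct (classic (K x)) as [Kx|nKx].
  - destruct (HK' x Px) as [k Hk]; [tauto|]. exists k. intros y [_ Ky]. auto.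
  - destruct (HK x Px nKx) as [k Hk]. exists k. intros y [Ky _]. auto.
Qed.

(** Apply [lf_lambda] to all columns of points of [A]. An array with a column above [f] is kept away
    from [A] by that column; if there is no such column, all columns are among the [e n], and only
    countably many arrays of finite width arise in this way. *)
Lemma meager_space_countable_is_Gdelta L (A : array -> Prop) :
  lambda_family L -> countable_set A -> (forall x, A x -> meager_space L x) ->
  exists F : nat -> array -> Prop,
    (forall n, closed_in (meager_space L) (F n)) /\
    (forall n, exists N, forall x, F n x -> width_le N x) /\
    (forall n x, F n x -> meager_space L x /\ ~ A x) /\
    (forall x, meager_space L x -> ~ A x -> exists n, F n x).
Proof.
  intros HL [a Ha] HA.
  destruct (choice_fun (fun n (c : nat -> nat) => L c /\ forall l i, pairing n = (l, i) ->
              A (a l) -> c = column i (a l))) as [c Hc].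
  { intros n. destruct (pairing n) as [l i] eqn:E.
    destruct (classic (A (a l))) as [Al|nAl].
    - exists (column i (a l)). split; [now apply HA|]. congruence.
    - exists (fun _ => 0). split; [now apply lf_zero|]. intros; exfalso; congruence. }
  destruct (lf_lambda L HL c) as [f [Hf [e He]]]; [intros n; apply Hc|].
  apply choice_fun in Hf. destruct Hf as [m Hm].
  (* Column [i] differs from each [c n] before row [j + m n]. For each [n] this inspects finitely
     many rows, so the condition is closed. *)
  set (far := fun i j x => forall n, exists r, r < j + m n /\ column i x r <> c n r).
  set (en := fun N d r i => if i <? N then e (digit d i) r else 0).
  exists (fun n x => let (N, u) := pairing n in let (i, j) := pairing u in
     meager_space L x /\ width_le N x /\ (far i j x \/ (x = en N j /\ ~ A x))).
  split; [|split; [|split]].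
  - intros n. destruct (pairing n) as [N u]. destruct (pairing u) as [i j].
    assert (Hfar : closed_in (meager_space L) (far i j)).
    { intros x _ nx. apply not_all_ex_not in nx. destruct nx as [l nx].
      exists (j + m l). intros y Hy Hag. apply nx.
      destruct (Hy l) as [r [Hr Hne]]. exists r. split; auto.
      unfold column in *. now rewrite Hag. }
    assert (Hsing : closed_in (meager_space L) (fun x => x = en N j /\ ~ A x)).
    { intros x Yx nx. destruct (classic (x = en N j)) as [E|E].
      - exists 0. intros y [-> nA]. exfalso. apply nx. now rewrite E.
      - destruct (closed_in_singleton (meager_space L) (en N j) x Yx E) as [k Hk].
        exists k. intros y [Ey _]. now apply Hk. }
    assert (Hself : closed_in (meager_space L) (meager_space L)).
    { intros x Yx nYx. contradiction. }
    apply closed_in_inter; [exact Hself|].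
    apply closed_in_inter; [apply width_le_closed|]. now apply closed_in_union.
  - intros n. destruct (pairing n) as [N u]. destruct (pairing u) as [i j].
    exists N. tauto.
  - intros n x. destruct (pairing n) as [N u]. destruct (pairing u) as [i j].
    intros [Yx [_ Hx]]. split; auto. destruct Hx as [Hfar|[_ nA]]; auto. intros Ax.
    destruct (Ha x Ax) as [l <-]. destruct (pairing_surj l i) as [w Ew].
    destruct (Hfar w) as [r [_ Hne]]. apply Hne.
    now rewrite (proj2 (Hc w) l i Ew Ax).
  - intros x Yx nA. destruct (proj1 Yx) as [N HN].
    destruct (classic (exists i, lt_star f (column i x))) as [[i [k Hk]]|Hn].
    + destruct (pairing_surj i (S k)) as [u Eu]. destruct (pairing_surj N u) as [n En].
      exists n. rewrite En, Eu. split; [|split]; auto. left.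
      (* From this row on both [c l <= f] and [f < column i x] hold. The parameter [S k] makes the
         row admissible for the strict bound in [far]. *)
      intros l. exists (k + m l). split; [lia|]. intros E.
      specialize (Hk (k + m l) ltac:(lia)). specialize (Hm l (k + m l) ltac:(lia)). lia.
    + destruct (choice_fun (fun i n => e n = column i x)) as [g Hg].
      { intros i. destruct (He (column i x) (proj2 Yx i)) as [Hlt|Hn']; auto.
        exfalso. eauto. }
      destruct (digit_surj N g) as [d Hd].
      destruct (pairing_surj 0 d) as [u Eu]. destruct (pairing_surj N u) as [n En].
      exists n. rewrite En, Eu. split; [|split]; auto. right. split; auto.
      apply functional_extensionality. intros r. apply functional_extensionality. intros i.
      unfold en. destruct (Nat.ltb_spec i N) as [Hi|Hi].
      * rewrite Hd, Hg by auto. reflexivity.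
      * now apply HN.
Qed.

(** The rows of [p] put the copy at the desired node, the entry 1 in row [m] makes it leave the
    range there, and [t] in column [n] keeps it out of [B]. The other columns retain [x] from row
    [m] on, so nothing is lost there if its width is at most [n]. *)
Definition graft (t : nat -> nat) (n m : nat) (p x : array) : array :=
  fun r => if r <? m then p r
           else fun i => if i =? n then (if r =? m then 1 else t r) else x r i.

(** A canonical representative of the node of level [m], so that a choice made from it depends on
    the node alone. *)
Definition truncate (m : nat) (x : array) : array :=
  fun r => if r <? m then x r else fun _ => 0.

Lemma truncate_agree m x : agree m (truncate m x) x.
Proof. intros r Hr. unfold truncate. destruct (Nat.ltb_spec r m); [reflexivity|lia]. Qed.

Lemma truncate_eq m x y : agree m x y -> truncate m x = truncate m y.
Proof.
  intros H. apply functional_extensionality. intros r. unfold truncate.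
  destruct (Nat.ltb_spec r m); auto.
Qed.

Lemma graft_agree_prefix t n m p x : agree m (graft t n m p x) p.
Proof. intros r Hr. unfold graft. destruct (Nat.ltb_spec r m); [reflexivity|lia]. Qed.

Lemma graft_agree t n m p q x y k :
  agree m p q -> agree k x y -> agree k (graft t n m p x) (graft t n m q y).
Proof.
  intros Hpq Hxy r Hr. unfold graft. destruct (Nat.ltb_spec r m); auto.
  now rewrite (Hxy r Hr).
Qed.

Lemma graft_agree_inv t n m p q x y k :
  width_le n x -> width_le n y -> agree m x y ->
  agree k (graft t n m p x) (graft t n m q y) -> agree k x y.
Proof.
  intros Hx Hy Hm Hk r Hr. destruct (le_lt_dec m r) as [Hmr|Hmr]; [|now apply Hm].
  apply functional_extensionality. intros i.
  destruct (Nat.eq_dec i n) as [->|Hi]; [now rewrite Hx, Hy by lia|].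
  assert (E := f_equal (fun h => h i) (Hk r Hr)). unfold graft in E. simpl in E.
  destruct (Nat.ltb_spec r m); [lia|]. destruct (Nat.eqb_spec i n); [lia|exact E].
Qed.

Lemma graft_column t n m p x i :
  i <> n -> eq_star (column i (graft t n m p x)) (column i x).
Proof.
  intros Hi. exists m. intros r Hr. unfold column, graft.
  destruct (Nat.ltb_spec r m); [lia|]. destruct (Nat.eqb_spec i n); [lia|reflexivity].
Qed.

Lemma graft_new_column t n m p x : eq_star (column n (graft t n m p x)) t.
Proof.
  exists (S m). intros r Hr. unfold column, graft.
  destruct (Nat.ltb_spec r m); [lia|]. rewrite Nat.eqb_refl.
  destruct (Nat.eqb_spec r m); [lia|reflexivity].
Qed.

Lemma graft_marker t n m p x : graft t n m p x m n = 1.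
Proof.
  unfold graft. destruct (Nat.ltb_spec m m); [lia|]. now rewrite !Nat.eqb_refl.
Qed.

Lemma graft_meager_space L t n m p x :
  lambda_family L -> L t -> meager_space L p -> meager_space L x ->
  meager_space L (graft t n m p x).
Proof.
  intros HL Lt [[M HM] _] [[N HN] Hc]. split.
  - exists (Nat.max (S n) (Nat.max M N)). intros r i Hi. unfold graft.
    destruct (Nat.ltb_spec r m); [apply HM; lia|].
    destruct (Nat.eqb_spec i n); [lia|]. apply HN. lia.
  - intros i. destruct (Nat.eq_dec i n) as [->|Hi].
    + apply (lf_eq_star L HL t); auto. apply graft_new_column.
    + apply (lf_eq_star L HL (column i x)); auto. now apply graft_column.
Qed.

(* Every part of [F] branching off the domain of [H] at a node is copied, at the
   corresponding node of the range, with the same [t] in a column that is not yet used there;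
   as no column of an element of [B] is almost equal to [t], the copies avoid [B]. *)
Lemma extend_closed L A B H F N :
  lambda_family L -> good (meager_space L) A B H -> countable_set B ->
  closed_in (meager_space L) F -> (forall x, F x -> width_le N x) ->
  (forall x, F x -> meager_space L x /\ ~ A x) ->
  exists H', good (meager_space L) A B H' /\ (forall x y, H x y -> H' x y) /\
    (forall x, F x -> domain H' x).
Proof.
  intros HL HG [b Hb] HF HFN HFA.
  destruct (lf_large L HL (fun k => let (l, i) := pairing k in column i (b l))) as [t [Lt Ht]].
  assert (HtB : forall x n, eq_star (column n x) t -> ~ B x).
  { intros x n Hx Bx. destruct (Hb x Bx) as [l <-].
    destruct (pairing_surj l n) as [k Ek]. apply (Ht k). rewrite Ek. now apply eq_star_sym. }
  (* For each node a column is chosen that lies beyond the width of [F] and beyond all entries of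
     the next row of range points through that node. *)
  destruct (choice_fun (fun (ms : nat * array) n => N <= n /\ forall y, range H y ->
      agree (fst ms) (snd ms) y -> forall i, n <= i -> y (fst ms) i = 0)) as [nu0 Hnu0].
  { intros [m s]. destruct (good_thin_range _ _ _ _ HG m s) as [M HM].
    exists (Nat.max N M). split; [lia|]. intros y Hy Hag i Hi. apply (HM y Hy Hag). lia. }
  set (nu := fun m p => nu0 (m, truncate m p)).
  assert (HnuN : forall m p, N <= nu m p) by (intros; apply Hnu0).
  assert (Hnu : forall m p y, range H y -> agree m p y -> forall i, nu m p <= i -> y m i = 0).
  { intros m p y Hy Hag. apply (Hnu0 (m, truncate m p)); auto. simpl.
    eapply agree_trans; [apply truncate_agree|exact Hag]. }
  assert (Hnu_eq : forall m p q, agree m p q -> nu m p = nu m q).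
  { intros m p q Hpq. unfold nu. now rewrite (truncate_eq m p q Hpq). }
  assert (HFw : forall m p x, F x -> width_le (nu m p) x).
  { intros m p x Fx r i Hi. apply (HFN x Fx). specialize (HnuN m p). lia. }
  set (off := fun m x => forall q, domain H q -> ~ agree (S m) x q).
  set (G := fun x x' => exists m p p', F x /\ H p p' /\ agree m x p /\ off m x /\
              x' = graft t (nu m p') m p' x).
  (* A copy has the entry 1 where all range points through its node have 0. *)
  assert (Hmark : forall m p' x q', range H p' -> range H q' ->
             ~ agree (S m) (graft t (nu m p') m p' x) q').
  { intros m p' x q' Hp' Hq' Hag.
    assert (E : q' m (nu m p') = 0).
    { apply (Hnu m p' q'); auto. apply agree_trans with (graft t (nu m p') m p' x).
      - apply agree_sym, graft_agree_prefix.
      - eapply agree_le; [|exact Hag]. lia. }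
    rewrite <- (Hag m) in E by lia. rewrite graft_marker in E. discriminate. }
  assert (Hbranch : forall m p p' x, H p p' -> agree m x p -> off m x ->
             branch H m x (graft t (nu m p') m p' x)).
  { intros m p p' x Hp Hxp Hoff. split; [|split]; auto.
    - exists p, p'. split; [|split]; auto. apply graft_agree_prefix.
    - intros q' Hq'. apply Hmark; auto. exists p. exact Hp. }
  assert (HGY : forall x x', G x x' -> meager_space L x /\ meager_space L x' /\ ~ A x /\ ~ B x').
  { intros x x' [m [p [p' [Fx [Hp [Hxp [Hoff ->]]]]]]].
    destruct (HFA x Fx) as [Yx nA]. split; [|split; [|split]]; auto.
    - apply graft_meager_space; auto. now apply (good_in _ _ _ _ HG p p' Hp).
    - apply (HtB _ (nu m p')). apply graft_new_column. }
  assert (Hdom : forall x, domain (fun x y => H x y \/ G x y) x <-> (domain H x \/ F x)).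
  { intros x. split.
    - intros [y [Hy|[m [p [p' [Fx _]]]]]]; [left; exists y; auto|auto].
    - intros [[y Hy]|Fx]; [exists y; auto|].
      destruct (classic (domain H x)) as [[y Hy]|nD]; [exists y; auto|].
      destruct (branch_exists _ _ _ _ x HG) as [m [p [p' [Hp [Hxp Hoff]]]]]; auto.
      { now apply HFA. }
      exists (graft t (nu m p') m p' x). right. exists m, p, p'. repeat split; auto. }
  assert (Edom : domain (fun x y => H x y \/ G x y) = fun x => domain H x \/ F x).
  { apply functional_extensionality. intros x. now apply propositional_extensionality. }
  exists (fun x y => H x y \/ G x y). split; [|split; [auto|intros x Fx; apply Hdom; auto]].
  split.
  - intros x y [Hxy|Gxy]; [now apply HG|]. destruct (HGY x y Gxy) as [? [? [? ?]]]. tauto.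
  - apply isometric_union; [apply HG| |].
    + intros x x' [m [p [p' [Fx [Hp [Hxp [Hoff ->]]]]]]]. exists m. eauto.
    + intros m x x' y y' [m1 [p [p' [Fx [Hp [Hxp [Hoff ->]]]]]]]
        [m2 [q [q' [Fy [Hq [Hyq [Hoff' ->]]]]]]] [[p1 [p1' [Hp1 [Hx1 _]]]] [B1 _]]
        [[q1 [q1' [Hq1 [Hy1 _]]]] [B2 _]] Hxy k.
      assert (m1 = m) as ->.
      { eapply (branch_level (domain H) m1 m x p p1); eauto; [exists p'|exists p1']; auto. }
      assert (m2 = m) as ->.
      { eapply (branch_level (domain H) m2 m y q q1); eauto; [exists q'|exists q1']; auto. }
      (* The two points leave at the same node, so do their images, and both copies use the same
         column; grafting then preserves agreement in both directions. *)
      assert (Hpq : agree m p' q').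
      { apply (good_isometric _ _ _ _ HG p p' q q' m Hp Hq).
        apply agree_trans with x; [now apply agree_sym|]. now apply agree_trans with y. }
      rewrite (Hnu_eq m p' q' Hpq). split.
      * now apply graft_agree.
      * apply graft_agree_inv; auto.
  - destruct (good_nonempty _ _ _ _ HG) as [x [y Hxy]]. eauto.
  - rewrite Edom. apply closed_in_union; auto. apply HG.
  - intros y Yy nR.
    assert (nRH : ~ range H y).
    { intros [x Hx]. apply nR. exists x. auto. }
    destruct (branch_exists _ _ _ _ y (good_converse _ _ _ _ HG) Yy nRH)
      as [m [q' [q [Hq [Hyq Hoff]]]]].
    change (H q q') in Hq. change (forall z, range H z -> ~ agree (S m) y z) in Hoff.
    set (n := nu m q').
    (* The only candidate for a preimage of [y] under grafting: the prefix is moved back to [q] and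
       the extra column is cleared. *)
    set (y0 := fun r => if r <? m then q r else fun i => if i =? n then 0 else y r i).
    destruct (good_in _ _ _ _ HG q q' Hq) as [[[M HM] Hqc] [Yq' _]].
    assert (Yy0 : meager_space L y0).
    { destruct Yy as [[M' HM'] Hc]. split.
      - exists (Nat.max M M'). intros r i Hi. unfold y0.
        destruct (r <? m); [apply HM; lia|]. destruct (i =? n); [lia|apply HM'; lia].
      - intros i. destruct (Nat.eq_dec i n) as [->|Hi].
        + apply (lf_eq_star L HL (fun _ => 0)); [now apply lf_zero|]. exists m. intros r Hr.
          unfold column, y0. destruct (Nat.ltb_spec r m); [lia|]. now rewrite Nat.eqb_refl.
        + apply (lf_eq_star L HL (column i y)); auto. exists m. intros r Hr.
          unfold column, y0. destruct (Nat.ltb_spec r m); [lia|].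
          destruct (Nat.eqb_spec i n); [lia|reflexivity]. }
    (* A new range point agreeing with [y] beyond level [m] must be a copy made at the node of [q'],
       and its original is as close to [y0] as the copy is to [y]. *)
    assert (Hclaim : forall k x', S m <= k -> range (fun x y => H x y \/ G x y) x' ->
              agree k y x' -> exists x p', x' = graft t n m p' x /\ agree m p' q' /\
                F x /\ off m x /\ agree k y0 x).
    { intros k x' Hk [x [Hx|Gx]] Hag.
      { exfalso. apply (Hoff x'); [exists x; auto|]. eapply agree_le; eauto. }
      destruct Gx as [m1 [p [p' [Fx [Hp [Hxp [Hoffx Ex]]]]]]].
      assert (m1 = m) as ->.
      { eapply (branch_level (range H) m1 m x' p' q').
        - intros z Hz. rewrite Ex. apply Hmark; auto. exists p. exact Hp.
        - intros z Hz Hxz. apply (Hoff z Hz). apply agree_trans with x'; auto.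
          eapply agree_le; eauto.
        - exists p. exact Hp.
        - exists q. exact Hq.
        - rewrite Ex. apply graft_agree_prefix.
        - apply agree_trans with y; auto. apply agree_sym. apply (agree_le m k); auto; lia. }
      assert (Hpq : agree m p' q').
      { apply agree_trans with x'.
        - rewrite Ex. apply agree_sym, graft_agree_prefix.
        - apply agree_trans with y; auto. apply agree_sym. apply (agree_le m k); auto; lia. }
      exists x, p'. unfold n. rewrite <- (Hnu_eq m p' q' Hpq). repeat split; auto.
      intros r Hr. unfold y0. destruct (Nat.ltb_spec r m) as [Hrm|Hrm].
      - rewrite (Hxp r Hrm). symmetry.
        apply (proj2 (good_isometric _ _ _ _ HG p p' q q' m Hp Hq) Hpq r Hrm).
      - apply functional_extensionality. intros i.
        assert (E : y r i = x' r i) by (now rewrite (Hag r Hr)).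
        destruct (Nat.eqb_spec i n) as [->|Hi].
        + symmetry. apply (HFw m q' x Fx). unfold n. lia.
        + rewrite E, Ex. unfold graft. rewrite (Hnu_eq m p' q' Hpq).
          destruct (Nat.ltb_spec r m); [lia|].
          destruct (Nat.eqb_spec i (nu m q')); [contradiction|reflexivity]. }
    (* If [y0] is itself grafted at this node, nearby copies are close to its copy, which differs
       from [y]. Otherwise [y0] violates membership in [F] or the branching condition, and so do all
       sufficiently close arrays. *)
    destruct (classic (F y0)) as [Fy0|nFy0].
    + destruct (classic (off m y0)) as [Oy0|nOy0].
      * assert (Hne : exists k, ~ agree k y (graft t n m q' y0)).
        { apply not_all_ex_not. intros E. apply nR. exists y0. right. exists m, q, q'.
          split; [|split; [|split; [|split]]]; auto.
          - intros r Hr. unfold y0. destruct (Nat.ltb_spec r m); [reflexivity|lia].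
          - now apply agree_eq. }
        destruct Hne as [k Hk]. exists (k + S m). intros x' Hx' Hag.
        destruct (Hclaim (k + S m) x' ltac:(lia) Hx' Hag) as [x [p' [-> [Hpq [Fx [_ Hy0]]]]]].
        apply Hk. apply agree_trans with (graft t n m p' x).
        -- apply (agree_le k (k + S m)); auto; lia.
        -- apply graft_agree; auto. apply agree_sym. apply (agree_le k (k + S m)); auto; lia.
      * exists (S m). intros x' Hx' Hag.
        destruct (Hclaim (S m) x' ltac:(lia) Hx' Hag) as [x [p' [_ [_ [_ [Ox Hy0]]]]]].
        apply nOy0. intros z Hz Hy0z. apply (Ox z Hz).
        apply agree_trans with y0; auto. now apply agree_sym.
    + destruct (HF y0 Yy0 nFy0) as [k Hk]. exists (k + S m). intros x' Hx' Hag.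
      destruct (Hclaim (k + S m) x' ltac:(lia) Hx' Hag) as [x [p' [_ [_ [Fx [_ Hy0]]]]]].
      apply (Hk x Fx). apply (agree_le k (k + S m)); auto; lia.
  - rewrite Edom. apply thin_union; [apply HG|]. intros k x. exists N.
    intros y Fy _ i Hi. now apply (HFN y Fy).
  (* Copies leaving at a level up to [k] have row [k] bounded by the column chosen at one of the
     finitely many nodes along [s]; those leaving later share row [k] with an old range point. *)
  - intros k s. destruct (good_thin_range _ _ _ _ HG k s) as [M HM].
    destruct (bounded_prefix (fun m => nu m s) k) as [b' Hb'].
    exists (Nat.max M (S b')). intros x' [x [Hx|Gx]] Hag i Hi.
    + apply (HM x'); auto; [exists x; auto|lia].
    + destruct Gx as [m [p [p' [Fx [Hp [Hxp [Hoff Ex]]]]]]].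
      assert (Hx'p : agree m x' p') by (rewrite Ex; apply graft_agree_prefix).
      destruct (le_lt_dec m k) as [Hmk|Hkm].
      * assert (Hsp : agree m s p').
        { apply agree_trans with x'; auto. eapply agree_le; eauto. }
        specialize (Hb' m Hmk). rewrite (Hnu_eq m s p' Hsp) in Hb'.
        rewrite Ex. unfold graft. destruct (Nat.ltb_spec k m); [lia|].
        destruct (Nat.eqb_spec i (nu m p')); [lia|]. apply (HFw m p' x Fx). lia.
      * rewrite (Hx'p k Hkm). apply (HM p'); [exists p; auto| |lia].
        apply agree_trans with x'; auto. apply (agree_le k m); auto; lia.
Qed.

(** The backward half of a step is the forward half applied to the converse relation. *)
Lemma back_and_forth_alternating P A B (D R : nat -> array -> Prop) :
  (forall x, P x -> finite_rows x) -> (exists x, P x) ->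
  (forall x, A x -> P x) -> (forall x, B x -> P x) -> dense_in P A -> dense_in P B ->
  (forall n H, good P A B H -> exists H', good P A B H' /\
     (forall x y, H x y -> H' x y) /\ (forall x, D n x -> domain H' x)) ->
  (forall n H, good P B A H -> exists H', good P B A H' /\
     (forall x y, H x y -> H' x y) /\ (forall x, R n x -> domain H' x)) ->
  exists H, isometric H /\ (forall x y, H x y -> P x /\ P y /\ (A x <-> B y)) /\
    (forall n x, D n x -> domain H x) /\ (forall n y, R n y -> range H y).
Proof.
  intros Hfin [x0 Px0] HA HB dA dB HD HR.
  destruct (dA x0 0 Px0) as [a [Aa _]]. destruct (dB x0 0 Px0) as [b [Bb _]].
  apply back_and_forth with (fun x y => x = a /\ y = b).
  - apply good_singleton; auto.
  - intros n H HG. destruct (HD n H HG) as [H1 [HG1 [Hsub1 HD1]]].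
    destruct (HR n _ (good_converse _ _ _ _ HG1)) as [H2 [HG2 [Hsub2 HR2]]].
    exists (converse H2). split; [|split; [|split]].
    + exact (good_converse _ _ _ _ HG2).
    + intros x y Hxy. apply Hsub2, Hsub1, Hxy.
    + intros x Dx. destruct (HD1 x Dx) as [y Hy]. exists y. apply Hsub2, Hy.
    + exact HR2.
Qed.

Definition matching (P A B : array -> Prop) (H : array -> array -> Prop) : Prop :=
  isometric H /\ (forall x y, H x y -> P x /\ P y /\ (A x <-> B y)) /\
  (forall x, P x -> domain H x) /\ (forall y, P y -> range H y).

Lemma extend_enumerated_point P A B H a :
  row_extendable P -> (forall x, P x -> finite_rows x) ->
  (forall x, A x -> P x) -> (forall x, B x -> P x) -> dense_in P B ->
  good P A B H -> exists H', good P A B H' /\ (forall x y, H x y -> H' x y) /\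
     (forall x, A x /\ x = a -> domain H' x).
Proof.
  intros Hrow Hfin HA HB dB HG. destruct (classic (A a)) as [Aa|nAa].
  - destruct (extend_point P A B H a) as [H' [HG' [Hsub Ha]]]; auto.
    exists H'. split; [|split]; auto. intros x [_ ->]. exact Ha.
  - exists H. split; [|split]; auto. intros x [Ax ->]. contradiction.
Qed.

Lemma zero_meager_space L : lambda_family L -> meager_space L (fun _ _ => 0).
Proof.
  intros HL. split.
  - exists 0. intros r i _. reflexivity.
  - intros i. apply (lf_zero L HL).
Qed.

(** Step [n] adds to the domain the closed set [F n] disjoint from [A] and the [n]-th point of [A],
    and does the same for [B] on the range. These sets exhaust the space, so the union of the stages
    is total and onto. *)
Lemma meager_space_matching L A B :
  lambda_family L -> countable_set A -> countable_set B ->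
  (forall x, A x -> meager_space L x) -> (forall x, B x -> meager_space L x) ->
  dense_in (meager_space L) A -> dense_in (meager_space L) B ->
  exists H, matching (meager_space L) A B H.
Proof.
  intros HL cA cB HA HB dA dB.
  destruct (meager_space_countable_is_Gdelta L A HL cA HA) as [F [F1 [F2 [F3 F4]]]].
  destruct (meager_space_countable_is_Gdelta L B HL cB HB) as [G [G1 [G2 [G3 G4]]]].
  pose proof cA as [a Ha]. pose proof cB as [b Hb].
  assert (Hstep : forall A B F a, countable_set B ->
     (forall x, A x -> meager_space L x) -> (forall x, B x -> meager_space L x) ->
     dense_in (meager_space L) B -> closed_in (meager_space L) F ->
     (exists N, forall x, F x -> width_le N x) ->
     (forall x, F x -> meager_space L x /\ ~ A x) ->
     forall H, good (meager_space L) A B H -> exists H', good (meager_space L) A B H' /\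
       (forall x y, H x y -> H' x y) /\ (forall x, F x \/ A x /\ x = a -> domain H' x)).
  { clear - HL. intros A B F a cB HA HB dB F1 [N F2] F3 H HG.
    destruct (extend_closed L A B H F N HL HG cB F1 F2 F3) as [H1 [HG1 [Hsub1 HF1]]].
    destruct (extend_enumerated_point (meager_space L) A B H1 a) as [H2 [HG2 [Hsub2 Ha2]]]; auto.
    - now apply meager_space_row_extendable.
    - apply meager_space_finite_rows.
    - exists H2. split; [|split]; auto. intros x [Fx|Ax]; auto.
      destruct (HF1 x Fx) as [y Hy]. exists y. auto. }
  destruct (back_and_forth_alternating (meager_space L) A B
    (fun n x => F n x \/ A x /\ x = a n) (fun n x => G n x \/ B x /\ x = b n))
    as [H [H1 [H2 [H3 H4]]]]; auto.
  - apply meager_space_finite_rows.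
  - exists (fun _ _ => 0). now apply zero_meager_space.
  - intros n H0. apply Hstep; auto; apply F3.
  - intros n H0. apply Hstep; auto; apply G3.
  - exists H. split; [|split; [|split]]; auto.
    + intros x Yx. destruct (classic (A x)) as [Ax|nAx].
      * destruct (Ha x Ax) as [n En]. apply (H3 n). auto.
      * destruct (F4 x Yx nAx) as [n Fx]. apply (H3 n). auto.
    + intros x Yx. destruct (classic (B x)) as [Bx|nBx].
      * destruct (Hb x Bx) as [n En]. apply (H4 n). auto.
      * destruct (G4 x Yx nBx) as [n Gx]. apply (H4 n). auto.
Qed.

(** * The complete factor *)

Lemma finite_rows_row_extendable : row_extendable finite_rows.
Proof.
  intros x m N Hx r. destruct (Nat.eqb_spec r m) as [->|Hr].
  - exists (S N). intros i Hi. destruct (Nat.eqb_spec i N); [lia|reflexivity].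
  - apply Hx.
Qed.

(** The closure of the graph of [H]. *)
Definition completion (H : array -> array -> Prop) (x y : array) : Prop :=
  forall k, exists a b, H a b /\ agree k x a /\ agree k y b.

Lemma completion_isometric H : isometric H -> isometric (completion H).
Proof.
  intros Hiso x x' y y' k Hx Hy.
  destruct (Hx k) as [a [a' [Ha [Hxa Hxa']]]]. destruct (Hy k) as [b [b' [Hb [Hyb Hyb']]]].
  assert (E := Hiso a a' b b' k Ha Hb).
  assert (E1 : agree k x y <-> agree k a b).
  { split; intros F; eauto using agree_trans, agree_sym. }
  assert (E2 : agree k x' y' <-> agree k a' b').
  { split; intros F; eauto using agree_trans, agree_sym. }
  tauto.
Qed.

(** Images of points converging to [x] form a Cauchy sequence. Its limit takes row [r] from the
    image number [S r], so each of its rows is finitely supported. *)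
Lemma completion_total H A x :
  isometric H -> (forall a b, H a b -> finite_rows b) ->
  dense_in finite_rows A -> (forall a, A a -> domain H a) -> finite_rows x ->
  exists y, finite_rows y /\ completion H x y.
Proof.
  intros Hiso Hfin dA HA Hx.
  destruct (choice_fun (fun k (ab : array * array) => H (fst ab) (snd ab) /\ agree k x (fst ab)))
    as [ab Hab].
  { intros k. destruct (dA x k Hx) as [a [Aa Hxa]]. destruct (HA a Aa) as [b Hb].
    exists (a, b). auto. }
  assert (Hy : forall k, agree k (fun r => snd (ab (S r)) r) (snd (ab k))).
  { intros k r Hr.
    apply (proj1 (Hiso _ _ _ _ (S r) (proj1 (Hab (S r))) (proj1 (Hab k)))); [|lia].
    apply agree_trans with x; [apply agree_sym, Hab|].
    apply (agree_le (S r) k); [lia|apply Hab]. }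
  exists (fun r => snd (ab (S r)) r). split.
  - intros r. apply (Hfin _ _ (proj1 (Hab (S r)))).
  - intros k. exists (fst (ab k)), (snd (ab k)). split; [|split]; auto; apply Hab.
Qed.

Lemma completion_converse H x y : completion (converse H) x y -> completion H y x.
Proof. intros Hc k. destruct (Hc k) as [a [b [Hab [Hx Hy]]]]. exists b, a. auto. Qed.

(** Back and forth through single points gives an isometry between dense sets, which extends by
    completeness. The extension is injective, and [A] and [B] are already matched, so it sends no
    other point into [B]. *)
Lemma finite_rows_matching A B :
  countable_set A -> countable_set B ->
  (forall x, A x -> finite_rows x) -> (forall x, B x -> finite_rows x) ->
  dense_in finite_rows A -> dense_in finite_rows B ->
  exists H, matching finite_rows A B H.
Proof.
  intros [a Ha] [b Hb] HA HB dA dB.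
  destruct (back_and_forth_alternating finite_rows A B
    (fun n x => A x /\ x = a n) (fun n x => B x /\ x = b n)) as [H [H1 [H2 [H3 H4]]]]; auto.
  - exists (fun _ _ => 0). intros r. exists 0. auto.
  - intros n H. apply extend_enumerated_point; auto. apply finite_rows_row_extendable.
  - intros n H. apply extend_enumerated_point; auto. apply finite_rows_row_extendable.
  - assert (HdomA : forall x, A x -> domain H x).
    { intros x Ax. destruct (Ha x Ax) as [n En]. apply (H3 n). auto. }
    assert (HranB : forall y, B y -> range H y).
    { intros y By. destruct (Hb y By) as [n En]. apply (H4 n). auto. }
    assert (Hci := completion_isometric H H1).
    assert (Hincl : forall x y, H x y -> completion H x y).
    { intros x y Hxy k. exists x, y. auto using agree_refl. }
    assert (Hconv : isometric (converse H)).
    { intros x x' y y' k Hx Hy. symmetry. now apply H1. }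
    exists (fun x y => finite_rows x /\ finite_rows y /\ completion H x y).
    split; [|split; [|split]].
    + intros x x' y y' k [_ [_ Hx]] [_ [_ Hy]]. now apply Hci.
    + intros x y [Fx [Fy Hxy]]. split; [|split]; auto. split.
      * intros Ax. destruct (HdomA x Ax) as [y' Hy'].
        assert (y = y') as ->; [|now apply (H2 x y')].
        apply agree_eq. intros k. apply (Hci x y x y' k); auto using agree_refl.
      * intros By. destruct (HranB y By) as [x' Hx'].
        assert (x = x') as ->; [|now apply (H2 x' y)].
        apply agree_eq. intros k. apply (Hci x y x' y k); auto using agree_refl.
    + intros x Fx. destruct (completion_total H A x) as [y [Fy Hxy]]; auto.
      { intros u v Huv. now apply (H2 u v). }
      exists y. auto.
    + intros y Fy. destruct (completion_total (converse H) B y) as [x [Fx Hyx]]; auto.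
      { intros u v Huv. now apply (H2 v u). }
      exists x. split; [|split]; auto. now apply completion_converse.
Qed.

(** * Topologies of ultrametric type *)

Record refining {X : Type} (E : nat -> X -> X -> Prop) : Prop := {
  ref_refl : forall k x, E k x x;
  ref_sym : forall k x y, E k x y -> E k y x;
  ref_trans : forall k x y z, E k x y -> E k y z -> E k x z;
  ref_le : forall k l x y, k <= l -> E l x y -> E k x y;
  ref_eq : forall x y, (forall k, E k x y) -> x = y
}.

Definition ball_topology {X : Type} (E : nat -> X -> X -> Prop) : topology X :=
  fun U => forall x, U x -> exists k, forall y, E k x y -> U y.

Lemma ball_topology_is_topology {X : Type} (E : nat -> X -> X -> Prop) :
  refining E -> is_topology (ball_topology E).
Proof.
  intros HE. split; [|split].
  - intros x _. exists 0. auto.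
  - intros U V HU HV x [Ux Vx]. destruct (HU x Ux) as [k Hk]. destruct (HV x Vx) as [l Hl].
    exists (k + l). intros y Hy. split.
    + apply Hk. apply (ref_le E HE k (k + l)); auto; lia.
    + apply Hl. apply (ref_le E HE l (k + l)); auto; lia.
  - intros F HF x [U [FU Ux]]. destruct (HF U FU x Ux) as [k Hk].
    exists k. intros y Hy. exists U. auto.
Qed.

Lemma ball_open {X : Type} (E : nat -> X -> X -> Prop) k x :
  refining E -> ball_topology E (E k x).
Proof. intros HE y Hy. exists k. intros z Hz. eapply ref_trans; eauto. Qed.

Lemma ball_topology_zero_dimensional {X : Type} (E : nat -> X -> X -> Prop) :
  refining E -> zero_dimensional (ball_topology E).
Proof.
  intros HE U x HU Ux. destruct (HU x Ux) as [k Hk].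
  exists (E k x). split; [split|split]; auto.
  - now apply ball_open.
  - intros y Hy. exists k. intros z Hz Hxz. apply Hy.
    eapply ref_trans; eauto. now apply ref_sym.
  - now apply ref_refl.
Qed.

(** The metric is the ultrametric with value [1 / (l + 1)], where [l] is the first level separating
    the two points. *)
Lemma ball_topology_metrizable {X : Type} (E : nat -> X -> X -> Prop) :
  refining E -> metrizable (ball_topology E).
Proof.
  intros HE.
  destruct (choice_fun (fun (xy : X * X) l => fst xy <> snd xy ->
              forall k, E k (fst xy) (snd xy) <-> k < l)) as [l Hl].
  { intros [x y]. simpl. destruct (classic (x = y)) as [->|Hne]; [exists 0; intros []; auto|].
    destruct (classic (E 0 x y)) as [H0|H0].
    - destruct (least_failure (fun k => E k x y)) as [m [Hm HSm]]; auto.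
      { apply not_all_ex_not. intros Hall. apply Hne. now apply (ref_eq E HE). }
      exists (S m). intros _ k. split.
      + intros Hk. destruct (le_lt_dec (S m) k) as [Hle|Hlt]; auto. exfalso.
        apply HSm. apply (ref_le E HE (S m) k); auto.
      + intros Hk. apply (ref_le E HE k m); auto; lia.
    - exists 0. intros _ k. split; [|lia]. intros Hk. exfalso. apply H0.
      apply (ref_le E HE 0 k); auto; lia. }
  set (d := fun x y : X => if excluded_middle_informative (x = y) then 0%R
                           else (/ INR (S (l (x, y))))%R).
  assert (Hpos : forall n, (0 < / INR (S n))%R).
  { intros n. apply Rinv_0_lt_compat, lt_0_INR. lia. }
  assert (Hd0 : forall x, d x x = 0%R).
  { intros x. unfold d. destruct (excluded_middle_informative (x = x)); [auto|contradiction]. }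
  assert (Hdne : forall x y, x <> y -> d x y = (/ INR (S (l (x, y))))%R).
  { intros x y Hne. unfold d. destruct (excluded_middle_informative (x = y)); [contradiction|auto]. }
  assert (Hinv : forall n m, n <= m -> (/ INR (S m) <= / INR (S n))%R).
  { intros n m Hnm. apply Rinv_le_contravar; [apply lt_0_INR; lia|apply le_INR; lia]. }
  assert (Hball : forall x y k, (d x y < / INR (S k))%R <-> E k x y).
  { intros x y k. destruct (classic (x = y)) as [->|Hne].
    - rewrite Hd0. split; intros _; [now apply ref_refl|apply Hpos].
    - rewrite (Hdne x y Hne). rewrite (Hl (x, y) Hne k). split.
      + intros Hlt. destruct (le_lt_dec (l (x, y)) k) as [Hle|]; auto.
        specialize (Hinv _ _ Hle). lra.
      + intros Hlt. apply Rinv_lt_contravar; [|apply lt_INR; lia].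
        apply Rmult_lt_0_compat; apply lt_0_INR; lia. }
  exists d. split; [split; [|split; [|split]]|].
  - intros x y. destruct (classic (x = y)) as [->|Hne]; [rewrite Hd0; lra|].
    rewrite Hdne by auto. apply Rlt_le, Hpos.
  - intros x y. split; [|intros ->; apply Hd0]. intros H0. apply NNPP. intros Hne.
    rewrite Hdne in H0 by auto. specialize (Hpos (l (x, y))). lra.
  - intros x y. destruct (classic (x = y)) as [->|Hne]; auto.
    rewrite !Hdne by auto. do 3 f_equal.
    assert (Hs : forall k, k < l (x, y) <-> k < l (y, x)).
    { intros k. rewrite <- (Hl (x, y) Hne k), <- (Hl (y, x) (not_eq_sym Hne) k). simpl.
      split; now apply ref_sym. }
    destruct (lt_eq_lt_dec (l (x, y)) (l (y, x))) as [[H|H]|H]; auto.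
    + apply Hs in H. lia.
    + apply Hs in H. lia.
  - intros x y z. destruct (classic (x = y)) as [->|Hxy]; [rewrite Hd0; lra|].
    destruct (classic (y = z)) as [->|Hyz]; [rewrite Hd0; lra|].
    destruct (classic (x = z)) as [->|Hxz].
    { rewrite Hd0, !Hdne by auto. generalize (Hpos (l (z, y))) (Hpos (l (y, z))). lra. }
    rewrite !Hdne by auto.
    (* Transitivity at level [l (x, z)]: were both [x], [y] and [y], [z] still together there, so
       would be [x] and [z]. *)
    assert (Hm : l (x, y) <= l (x, z) \/ l (y, z) <= l (x, z)).
    { destruct (le_lt_dec (l (x, y)) (l (x, z))) as [|H1]; auto.
      destruct (le_lt_dec (l (y, z)) (l (x, z))) as [|H2]; auto. exfalso.
      apply (Hl (x, y) Hxy) in H1. apply (Hl (y, z) Hyz) in H2. simpl in *.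
      assert (H3 : E (l (x, z)) x z) by (eapply ref_trans; eauto).
      apply (Hl (x, z) Hxz) in H3. lia. }
    generalize (Hpos (l (x, y))) (Hpos (l (y, z))).
    destruct Hm as [Hm|Hm]; apply Hinv in Hm; lra.
  - intros U. split; intros HU x Ux; destruct (HU x Ux) as [k Hk].
    + exists (/ INR (S k))%R. split; [apply Hpos|]. intros y Hy. apply Hk, Hball, Hy.
    + destruct Hk as [Hk HkU].
      destruct (archimed_cor1 k Hk) as [n [Hn Hn0]]. exists n. intros y Hy. apply HkU.
      apply Hball in Hy. eapply Rlt_trans; [exact Hy|].
      eapply Rle_lt_trans; [|exact Hn]. apply Rinv_le_contravar; [now apply lt_0_INR|].
      apply le_INR. lia.
Qed.

Lemma ball_topology_dense {X : Type} (E : nat -> X -> X -> Prop) (A : X -> Prop) :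
  refining E -> (dense (ball_topology E) A <-> forall x k, exists a, A a /\ E k x a).
Proof.
  intros HE. split.
  - intros HA x k. destruct (HA (E k x)) as [a [Ha Aa]].
    + now apply ball_open.
    + exists x. now apply ref_refl.
    + eauto.
  - intros HA U HU [x Ux]. destruct (HU x Ux) as [k Hk]. destruct (HA x k) as [a [Aa Ha]].
    exists a. auto.
Qed.

Lemma isometry_homeomorphism {X : Type} (E : nat -> X -> X -> Prop) (h g : X -> X) :
  (forall k x y, E k x y -> E k (h x) (h y)) -> (forall k x y, E k x y -> E k (g x) (g y)) ->
  (forall x, g (h x) = x) -> (forall y, h (g y) = y) -> homeomorphism (ball_topology E) h.
Proof.
  intros Hh Hg Hgh Hhg.
  assert (Hc : forall f, (forall k x y, E k x y -> E k (f x) (f y)) ->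
            continuous (ball_topology E) (ball_topology E) f).
  { intros f Hf V HV x Vx. destruct (HV _ Vx) as [k Hk]. exists k. intros y Hy. auto. }
  split; auto. exists g. auto.
Qed.

(** * The sum of the meager and the complete factor *)

Definition carrier (L : (nat -> nat) -> Prop) (s : bool) : array -> Prop :=
  if s then meager_space L else finite_rows.

Definition space (L : (nat -> nat) -> Prop) : Type :=
  {p : bool * array | carrier L (fst p) (snd p)}.

Definition side {L} (p : space L) : bool := fst (proj1_sig p).
Definition arr {L} (p : space L) : array := snd (proj1_sig p).
Definition point {L} (s : bool) (x : array) (Hx : carrier L s x) : space L :=
  exist _ (s, x) Hx.

(** Level 0 already distinguishes the sides, so each side is clopen and the topology is that of the
    disjoint sum. *)
Definition near {L} (k : nat) (p q : space L) : Prop :=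
  side p = side q /\ agree k (arr p) (arr q).

Lemma arr_carrier {L} (p : space L) : carrier L (side p) (arr p).
Proof. exact (proj2_sig p). Qed.

Lemma space_eq {L} (p q : space L) : side p = side q -> arr p = arr q -> p = q.
Proof.
  destruct p as [[s x] Hx], q as [[s' x'] Hx']. unfold side, arr. simpl. intros -> ->.
  f_equal. apply proof_irrelevance.
Qed.

Lemma near_refining L : refining (@near L).
Proof.
  split.
  - intros k p. split; auto using agree_refl.
  - intros k p q [E H]. split; auto using agree_sym.
  - intros k p q r [E H] [E' H']. split; [congruence|eapply agree_trans; eauto].
  - intros k l p q Hkl [E H]. split; auto. eapply agree_le; eauto.
  - intros p q H. apply space_eq.
    + apply (H 0).
    + apply agree_eq. intros k. apply H.
Qed.

Lemma carrier_matching L s A B :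
  lambda_family L -> countable_set A -> countable_set B ->
  (forall x, A x -> carrier L s x) -> (forall x, B x -> carrier L s x) ->
  dense_in (carrier L s) A -> dense_in (carrier L s) B ->
  exists H, matching (carrier L s) A B H.
Proof.
  intros HL. destruct s.
  - apply meager_space_matching. exact HL.
  - apply finite_rows_matching.
Qed.

(** Both sides are open, so [A] and [B] are dense in each of them. The matchings of the two sides
    are glued to [h], and [g] is glued from their converses. *)
Lemma space_CDH L : lambda_family L -> CDH (ball_topology (@near L)).
Proof.
  intros HL A B cA dA cB dB.
  assert (HE := near_refining L).
  rewrite (ball_topology_dense near A HE) in dA.
  rewrite (ball_topology_dense near B HE) in dB.
  set (part := fun (A : space L -> Prop) s x => exists p, A p /\ side p = s /\ arr p = x).
  assert (Hc : forall A s, countable_set A -> countable_set (part A s)).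
  { intros C s [f Hf]. exists (fun n => arr (f n)). intros x [p [Cp [_ <-]]].
    destruct (Hf p Cp) as [n <-]. eauto. }
  assert (Hp : forall A s x, part A s x -> carrier L s x).
  { intros C s x [p [_ [<- <-]]]. apply arr_carrier. }
  assert (Hd : forall A s, (forall x k, exists a, A a /\ near k x a) ->
                           dense_in (carrier L s) (part A s)).
  { intros C s dC x k Hx. destruct (dC (point s x Hx) k) as [a [Ca [Es Ha]]].
    exists (arr a). split; auto. exists a. auto. }
  assert (Hpart : forall A p, part A (side p) (arr p) <-> A p).
  { intros C p. split; [|exists p; auto]. intros [q [Cq [Es Ea]]].
    now rewrite (space_eq p q) by auto. }
  destruct (choice_fun (fun s H => matching (carrier L s) (part A s) (part B s) H)) as [H HH].
  { intros s. apply carrier_matching; auto; apply Hp. }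
  destruct (choice_fun (fun p q : space L => side p = side q /\ H (side p) (arr p) (arr q)))
    as [h Hh].
  { intros p. destruct (HH (side p)) as [_ [Hin [Hdom _]]].
    destruct (Hdom (arr p) (arr_carrier p)) as [y Hy].
    exists (point (side p) y (proj1 (proj2 (Hin _ _ Hy)))). auto. }
  destruct (choice_fun (fun q p : space L => side p = side q /\ H (side p) (arr p) (arr q)))
    as [g Hg].
  { intros q. destruct (HH (side q)) as [_ [Hin [_ Hran]]].
    destruct (Hran (arr q) (arr_carrier q)) as [x Hx].
    exists (point (side q) x (proj1 (Hin _ _ Hx))). auto. }
  assert (Hfun : forall p q p' q' : space L, side p = side q -> side p' = side q' ->
            H (side p) (arr p) (arr q) -> H (side p') (arr p') (arr q') ->
            forall k, near k p p' <-> near k q q').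
  { intros p q p' q' E E' Hpq Hpq' k. unfold near. rewrite <- E, <- E'.
    split; intros [Es Ha]; split; auto; rewrite <- Es in Hpq';
      apply (proj1 (HH (side p)) _ _ _ _ k Hpq Hpq'); exact Ha. }
  exists h. split.
  - apply isometry_homeomorphism with g.
    + intros k p q Hpq. apply (Hfun p (h p) q (h q)); auto; apply Hh.
    + intros k p q Hpq. apply (Hfun (g p) p (g q) q); auto; apply Hg.
    + intros p. apply (ref_eq _ HE). intros k.
      apply (Hfun (g (h p)) (h p) p (h p)); try apply Hg; try apply Hh. apply (ref_refl _ HE).
    + intros q. apply (ref_eq _ HE). intros k.
      apply (Hfun (g q) (h (g q)) (g q) q); try apply Hg; try apply Hh. apply (ref_refl _ HE).
  - assert (HAB : forall p, A p <-> B (h p)).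
    { intros p. destruct (Hh p) as [Es Hp']. destruct (HH (side p)) as [_ [Hin _]].
      rewrite <- (Hpart A p), <- (Hpart B (h p)), <- Es. now apply Hin. }
    intros q. split.
    + intros Bq. exists (g q).
      assert (Ehg : h (g q) = q).
      { apply (ref_eq _ HE). intros k.
        apply (Hfun (g q) (h (g q)) (g q) q); try apply Hg; try apply Hh.
        apply (ref_refl _ HE). }
      split; auto. apply HAB. now rewrite Ehg.
    + intros [p [Ap <-]]. now apply HAB.
Qed.

(** * The square *)

Lemma carrier_finite_rows L s x : carrier L s x -> finite_rows x.
Proof. destruct s; [apply meager_space_finite_rows|auto]. Qed.

Lemma carrier_row_extendable L s : lambda_family L -> row_extendable (carrier L s).
Proof.
  destruct s; [apply meager_space_row_extendable|intros _; apply finite_rows_row_extendable].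
Qed.

(** * Finitely supported arrays and their labelling *)

Definition finite_support (x : array) : Prop :=
  exists M, forall r i, M <= r \/ M <= i -> x r i = 0.

Lemma finite_support_carrier L s x : lambda_family L -> finite_support x -> carrier L s x.
Proof.
  intros HL [M HM]. destruct s.
  - split.
    + exists M. intros r i Hi. auto.
    + intros i. apply (lf_eq_star L HL (fun _ => 0)); [now apply lf_zero|].
      exists M. intros r Hr. apply HM. auto.
  - intros r. exists M. intros i Hi. auto.
Qed.

Definition fin (c : nat) : array := fun r i =>
  let (M, d) := pairing c in
  if ((r <? M) && (i <? M))%bool then digit (digit d r) i else 0.

Lemma fin_finite_support c : finite_support (fin c).
Proof.
  unfold fin. destruct (pairing c) as [M d]. exists M. intros r i H.
  destruct (Nat.ltb_spec r M), (Nat.ltb_spec i M); simpl; auto; lia.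
Qed.

Lemma fin_dense x k : finite_rows x -> exists c, agree k x (fin c).
Proof.
  intros Hx. destruct (choice_fun _ Hx) as [N HN].
  destruct (bounded_prefix N k) as [b Hb]. set (M := S (k + b)).
  destruct (choice_fun (fun r c => forall i, i < M -> digit c i = x r i)) as [g Hg].
  { intros r. apply digit_surj. }
  destruct (digit_surj M g) as [d Hd]. destruct (pairing_surj M d) as [c Hc].
  exists c. intros r Hr. apply functional_extensionality. intros i. unfold fin. rewrite Hc.
  destruct (Nat.ltb_spec r M) as [HrM|HrM]; [|unfold M in *; lia].
  destruct (Nat.ltb_spec i M) as [HiM|HiM]; simpl.
  - now rewrite Hd, Hg.
  - apply HN. specialize (Hb r). unfold M in *. lia.
Qed.

(* The last nonzero row records [n], so that distinct labels give distinct arrays. *)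
Definition labelled (c k n : nat) : array := fun r =>
  if r <? k then fin c r else if r =? k then (fun i => if i =? 0 then S n else 0)
  else fun _ => 0.

Lemma labelled_finite_support c k n : finite_support (labelled c k n).
Proof.
  destruct (fin_finite_support c) as [M HM]. exists (S (M + k)). intros r i H. unfold labelled.
  destruct (Nat.ltb_spec r k); [apply HM; lia|].
  destruct (Nat.eqb_spec r k); auto. destruct (Nat.eqb_spec i 0); auto; lia.
Qed.

Lemma labelled_agree c k n : agree k (fin c) (labelled c k n).
Proof. intros r Hr. unfold labelled. destruct (Nat.ltb_spec r k); [reflexivity|lia]. Qed.

Lemma labelled_corner c k n : labelled c k n k 0 = S n.
Proof. unfold labelled. destruct (Nat.ltb_spec k k); [lia|]. now rewrite Nat.eqb_refl. Qed.

Lemma labelled_inj c k n c' k' n' : labelled c k n = labelled c' k' n' -> n = n'.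
Proof.
  assert (Hlt : forall c k n c' k' n', k < k' -> labelled c k n <> labelled c' k' n').
  { clear. intros c k n c' k' n' Hk E. apply (f_equal (fun x => x k' 0)) in E.
    rewrite labelled_corner in E. unfold labelled in E.
    destruct (Nat.ltb_spec k' k); [lia|]. destruct (Nat.eqb_spec k' k); [lia|discriminate]. }
  intros E. destruct (lt_eq_lt_dec k k') as [[Hk|<-]|Hk].
  - exfalso. exact (Hlt _ _ _ _ _ _ Hk E).
  - apply (f_equal (fun x => x k 0)) in E. rewrite !labelled_corner in E. lia.
  - exfalso. exact (Hlt _ _ _ _ _ _ Hk (eq_sym E)).
Qed.

(** [n] codes a level [k] and the codes of two arrays to be approximated there. As it also serves as
    the label, it can be recovered from either coordinate of the pair. *)
Definition labelled_fst (n : nat) : array :=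
  let (k, ij) := pairing n in labelled (fst (pairing ij)) k n.
Definition labelled_snd (n : nat) : array :=
  let (k, ij) := pairing n in labelled (snd (pairing ij)) k n.

Lemma labelled_fst_finite_support n : finite_support (labelled_fst n).
Proof. unfold labelled_fst. destruct (pairing n). apply labelled_finite_support. Qed.

Lemma labelled_snd_finite_support n : finite_support (labelled_snd n).
Proof. unfold labelled_snd. destruct (pairing n). apply labelled_finite_support. Qed.

Lemma labelled_fst_inj n m : labelled_fst n = labelled_fst m -> n = m.
Proof. unfold labelled_fst. destruct (pairing n), (pairing m). apply labelled_inj. Qed.

Lemma labelled_snd_inj n m : labelled_snd n = labelled_snd m -> n = m.
Proof. unfold labelled_snd. destruct (pairing n), (pairing m). apply labelled_inj. Qed.

(** * The topology of the square and Baire category *)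

Definition pnear {L} (k : nat) (p q : space L * space L) : Prop :=
  near k (fst p) (fst q) /\ near k (snd p) (snd q).

Lemma pnear_refining L : refining (@pnear L).
Proof.
  assert (HE := near_refining L). split.
  - intros k p. split; apply (ref_refl _ HE).
  - intros k p q [H1 H2]. split; now apply (ref_sym _ HE).
  - intros k p q r [H1 H2] [H3 H4]. split; eapply (ref_trans _ HE); eauto.
  - intros k l p q Hkl [H1 H2]. split; eapply (ref_le _ HE); eauto.
  - intros [p1 p2] [q1 q2] H. f_equal; apply (ref_eq _ HE); intros k; apply (H k).
Qed.

Lemma product_topology_pnear L :
  product_topology (ball_topology (@near L)) (ball_topology (@near L)) = ball_topology pnear.
Proof.
  assert (HE := near_refining L).
  apply functional_extensionality. intros U. apply propositional_extensionality. split.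
  - intros HU p Up. destruct (HU p Up) as [V [W [HV [HW [Vp [Wp HVW]]]]]].
    destruct (HV _ Vp) as [k Hk]. destruct (HW _ Wp) as [l Hl].
    exists (k + l). intros q [H1 H2]. apply HVW.
    + apply Hk. apply (ref_le _ HE k (k + l)); auto; lia.
    + apply Hl. apply (ref_le _ HE l (k + l)); auto; lia.
  - intros HU p Up. destruct (HU p Up) as [k Hk].
    exists (near k (fst p)), (near k (snd p)).
    split; [now apply ball_open|]. split; [now apply ball_open|].
    split; [apply (ref_refl _ HE)|]. split; [apply (ref_refl _ HE)|].
    intros q H1 H2. apply Hk. split; auto.
Qed.

Lemma continuous_pnear {L} (h : space L * space L -> space L * space L) p k :
  continuous (ball_topology pnear) (ball_topology pnear) h ->
  exists l, forall q, pnear l p q -> pnear k (h p) (h q).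
Proof.
  intros Hh. apply (Hh (pnear k (h p))).
  - apply ball_open, pnear_refining.
  - apply (ref_refl _ (pnear_refining L)).
Qed.

Lemma complete_side L (p : nat -> space L) (k : nat -> nat) :
  side (p 0) = false -> (forall n, near (k n) (p n) (p (S n))) ->
  (forall n, k n < k (S n)) -> exists q, forall n, near (k n) (p n) q.
Proof.
  intros Hs Hp Hk.
  assert (HE := near_refining L).
  (* Hence row [r] is settled from [p (S r)] on, which explains the diagonal limit below. *)
  assert (Hkn : forall n, n <= k n).
  { induction n as [|n IH]; [lia|]. specialize (Hk n). lia. }
  assert (Hkm : forall n d, k n <= k (d + n)).
  { induction d as [|d IH]; simpl; auto. specialize (Hk (d + n)). lia. }
  assert (Hpm : forall n d, near (k n) (p n) (p (d + n))).
  { intros n d. induction d as [|d IH]; [apply (ref_refl _ HE)|].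
    apply (ref_trans _ HE _ _ (p (d + n))); auto.
    apply (ref_le _ HE (k n) (k (d + n))); [apply Hkm|apply Hp]. }
  assert (Hside : forall n, side (p n) = false).
  { intros n. rewrite <- Hs. symmetry. replace n with (n + 0) by lia. apply (Hpm 0 n). }
  assert (Hx : finite_rows (fun r => arr (p (S r)) r)).
  { intros r. apply (carrier_finite_rows L (side (p (S r)))). apply arr_carrier. }
  exists (point false _ Hx). intros n. split; [apply Hside|].
  intros r Hr. change (arr (p n) r = arr (p (S r)) r).
  destruct (le_ge_dec n (S r)) as [H|H].
  - replace (S r) with ((S r - n) + n) at 1 by lia. now apply (Hpm n (S r - n)).
  - symmetry. replace n with ((n - S r) + S r) by lia.
    apply (Hpm (S r) (n - S r)). apply Hkn.
Qed.

Definition closed_set {L} (C : space L * space L -> Prop) : Prop :=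
  ball_topology pnear (fun p => ~ C p).

Definition both_complete {L} (p : space L * space L) : Prop :=
  side (fst p) = false /\ side (snd p) = false.

(** If no [C n] contained a ball centred near [p0], balls could be shrunk to miss [C 0], [C 1] and
    so on. Both coordinates start on the complete side, so the centres converge, and the limit would
    lie in no [C n]. *)
Lemma baire_category L (C : nat -> space L * space L -> Prop) p0 k0 :
  (forall n, closed_set (C n)) -> both_complete p0 ->
  (forall q, pnear k0 p0 q -> exists n, C n q) ->
  exists n p k, pnear k0 p0 p /\ forall q, pnear k p q -> C n q.
Proof.
  intros HC [Hs1 Hs2] Hcov. apply NNPP. intros Hn.
  assert (HE := pnear_refining L).
  destruct (choice_fun (fun (a : nat * ((space L * space L) * nat)) (b : (space L * space L) * nat) =>
     pnear k0 p0 (fst (snd a)) -> k0 <= snd (snd a) ->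
     pnear (snd (snd a)) (fst (snd a)) (fst b) /\ snd (snd a) < snd b /\
     forall q, pnear (snd b) (fst b) q -> ~ C (fst a) q)) as [step Hstep].
  { intros [n [p k]]. simpl. destruct (classic (pnear k0 p0 p)) as [Hp|Hp].
    - assert (Hq : exists q, pnear k p q /\ ~ C n q).
      { apply NNPP. intros Hq. apply Hn. exists n, p, k. split; auto.
        intros q Hpq. apply NNPP. intros HCq. apply Hq. eauto. }
      destruct Hq as [q [Hpq HCq]]. destruct (HC n q HCq) as [l Hl].
      exists (q, S (k + l)). simpl. intros _ _. split; [|split]; auto; [lia|].
      intros q' Hq'. apply Hl. apply (ref_le _ HE l (S (k + l))); auto; lia.
    - exists (p, k). intros; contradiction. }
  set (s := fix s n := match n with 0 => (p0, k0) | S n => step (n, s n) end).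
  assert (Hs : forall n, pnear k0 p0 (fst (s n)) /\ k0 <= snd (s n)).
  { induction n as [|n [IH1 IH2]]; simpl.
    - split; auto. apply (ref_refl _ HE).
    - destruct (Hstep (n, s n) IH1 IH2) as [H1 [H2 _]]. simpl in H1, H2. split; [|lia].
      apply (ref_trans _ HE _ _ (fst (s n))); auto.
      apply (ref_le _ HE k0 (snd (s n))); auto. }
  assert (Hnext : forall n, pnear (snd (s n)) (fst (s n)) (fst (s (S n))) /\
            snd (s n) < snd (s (S n)) /\
            forall q, pnear (snd (s (S n))) (fst (s (S n))) q -> ~ C n q).
  { intros n. apply (Hstep (n, s n)); apply Hs. }
  destruct (complete_side L (fun n => fst (fst (s n))) (fun n => snd (s n))) as [q1 Hq1]; auto.
  { intros n. apply Hnext. }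
  { intros n. apply Hnext. }
  destruct (complete_side L (fun n => snd (fst (s n))) (fun n => snd (s n))) as [q2 Hq2]; auto.
  { intros n. apply Hnext. }
  { intros n. apply Hnext. }
  assert (Hq : forall n, pnear (snd (s n)) (fst (s n)) (q1, q2)).
  { intros n. split; [apply Hq1|apply Hq2]. }
  destruct (Hcov (q1, q2) (Hq 0)) as [n HCn].
  destruct (Hnext n) as [_ [_ Hno]]. exact (Hno _ (Hq (S n)) HCn).
Qed.

Lemma width_le_row_extend N l (x : array) :
  ~ width_le N (fun r => if r =? l then (fun i => if i =? N then 1 else 0) else x r).
Proof.
  intros H. specialize (H l N (le_n N)). simpl in H. rewrite !Nat.eqb_refl in H. discriminate.
Qed.

Lemma agree_row_extend l N (x : array) :
  agree l x (fun r => if r =? l then (fun i => if i =? N then 1 else 0) else x r).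
Proof. intros r Hr. destruct (Nat.eqb_spec r l); [lia|reflexivity]. Qed.

(* The square of the complete side is Baire, whereas the points whose first coordinate is on
   the meager side are covered by the nowhere dense sets given by [width_le N]. *)
Lemma both_complete_preserved L (h g : space L * space L -> space L * space L) p :
  lambda_family L ->
  continuous (ball_topology pnear) (ball_topology pnear) h ->
  continuous (ball_topology pnear) (ball_topology pnear) g ->
  (forall p, g (h p) = p) -> (forall p, h (g p) = p) ->
  both_complete p -> side (fst (h p)) = false.
Proof.
  intros HL Hh Hg Hgh Hhg Hp. apply Bool.not_true_is_false. intros Hside.
  destruct (continuous_pnear h p 0 Hh) as [k0 Hk0].
  destruct (baire_category L (fun N q => side (fst (h q)) = true /\ width_le N (arr (fst (h q)))) p k0)
    as [N [q [k [_ Hq]]]]; auto.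
  - intros N. change (ball_topology pnear (fun q => (fun y => ~ (side (fst y) = true /\
                       width_le N (arr (fst y)))) (h q))).
    apply Hh. intros y Hy. destruct (classic (side (fst y) = true)) as [Es|Es].
    + destruct (width_le_closed (fun _ => True) N (arr (fst y)) I) as [k Hk]; [tauto|].
      exists k. intros z [[_ Hz] _] [_ Hw]. exact (Hk _ Hw Hz).
    + exists 0. intros z [[Ez _] _] [Ez' _]. congruence.
  - intros q Hq. destruct (Hk0 q Hq) as [[Es _] _].
    assert (Eq : side (fst (h q)) = true) by congruence.
    assert (Hc := arr_carrier (fst (h q))). rewrite Eq in Hc.
    destruct Hc as [[N HN] _]. exists N. auto.
  - destruct (Hq q (ref_refl _ (pnear_refining L) k q)) as [Eq _].
    (* An entry in column [N] of a far row violates the width bound while staying so close to [h q]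
       that [g] maps the new point into the ball around [q]. *)
    destruct (continuous_pnear g (h q) k Hg) as [l Hl]. rewrite Hgh in Hl.
    set (y := point (side (fst (h q))) _
                (carrier_row_extendable L _ HL (arr (fst (h q))) l N (arr_carrier (fst (h q))))).
    assert (Hy : pnear l (h q) (y, snd (h q))).
    { split; simpl.
      - split; [reflexivity|]. apply agree_row_extend.
      - apply (ref_refl _ (near_refining L)). }
    destruct (Hq _ (Hl _ Hy)) as [_ Hw]. rewrite Hhg in Hw.
    exact (width_le_row_extend _ _ _ Hw).
Qed.

(** * Two countable dense subsets of the square *)

Definition avoiding {L} (F : nat -> array -> Prop) (v w : nat -> array) (j k : nat)
  (p q : space L) : Prop :=
  side p = true /\ (F j (arr p) \/ (arr p = v j /\ ~ agree k (arr q) (w j))).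

Lemma avoiding_closed L F v w j k (p q : space L) :
  closed_in (meager_space L) (F j) -> ~ avoiding F v w j k p q ->
  exists l, forall p' q', near l p p' -> near l q q' -> ~ avoiding F v w j k p' q'.
Proof.
  intros HF Hn. destruct (classic (side p = true)) as [Es|Es].
  - assert (Hc := arr_carrier p). rewrite Es in Hc.
    destruct (HF (arr p) Hc) as [l1 Hl1].
    { intros HFp. apply Hn. split; auto. }
    assert (Hl2 : exists l2, forall p' q', near l2 p p' -> near l2 q q' ->
              ~ (arr p' = v j /\ ~ agree k (arr q') (w j))).
    { destruct (classic (arr p = v j)) as [E|E].
      - exists k. intros p' q' _ [_ Hq] [_ Hw]. apply Hn. split; auto. right. split; auto.
        intros Hqw. apply Hw. apply agree_trans with (arr q); auto. now apply agree_sym.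
      - destruct (closed_in_singleton (fun _ => True) (v j) (arr p) I E) as [l2 Hl2].
        exists l2. intros p' q' [_ Hp] _ [E' _]. exact (Hl2 _ E' Hp). }
    destruct Hl2 as [l2 Hl2]. exists (l1 + l2). intros p' q' Hp Hq [_ [HFp|Hw]].
    + apply (Hl1 _ HFp). apply (agree_le l1 (l1 + l2)); [lia|apply Hp].
    + apply (Hl2 p' q'); auto; apply (ref_le _ (near_refining L) l2 (l1 + l2)); auto; lia.
  - exists 0. intros p' q' [Ep _] _ [Es' _]. congruence.
Qed.

Lemma avoiding_disjoint L F v w j k n (p q : space L) :
  (forall n m, v n = v m -> n = m) -> (forall j x, F j x -> forall m, v m <> x) ->
  arr p = v n -> arr q = w n -> ~ avoiding F v w j k p q.
Proof.
  intros Hinj HF Ep Eq [_ [HFp|[E Hw]]].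
  - apply (HF j _ HFp n). auto.
  - rewrite Ep in E. apply Hinj in E. subst j. apply Hw. rewrite Eq. apply agree_refl.
Qed.

(** If [p] is no [v m], it lies in some [F j], whatever [q] is. Over [p = v m] only the point [w m]
    has to be avoided, and [q] differs from it in finitely many rows. *)
Lemma avoiding_cover L F v w (p q : space L) :
  (forall x, meager_space L x -> (forall m, v m <> x) -> exists j, F j x) ->
  side p = true -> ~ (exists n, arr p = v n /\ arr q = w n) ->
  exists j k, avoiding F v w j k p q.
Proof.
  intros HF Es Hn. assert (Hc := arr_carrier p). rewrite Es in Hc.
  destruct (classic (exists m, v m = arr p)) as [[m Em]|Hm].
  - assert (Hw : exists k, ~ agree k (arr q) (w m)).
    { apply not_all_ex_not. intros Hall. apply Hn. exists m. split; auto. now apply agree_eq. }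
    destruct Hw as [k Hk]. exists m, k. split; auto.
  - destruct (HF (arr p) Hc) as [j Hj].
    { intros m Em. apply Hm. eauto. }
    exists j, 0. split; auto.
Qed.

Definition labelled_pairs {L} (p : space L * space L) : Prop :=
  exists n, arr (fst p) = labelled_fst n /\ arr (snd p) = labelled_snd n.

Definition fin_pairs {L} (p : space L * space L) : Prop :=
  exists c d, arr (fst p) = fin c /\ arr (snd p) = fin d.

(** Outside the square of the complete side some coordinate is on the meager side. The pairs are the
    graph of an injection in either direction, so [avoiding] can be used with that coordinate first;
    [b] tells which one it is. *)
Lemma labelled_pairs_Gdelta L : lambda_family L ->
  exists C : nat -> space L * space L -> Prop,
    (forall n, closed_set (C n)) /\ (forall n p, C n p -> ~ labelled_pairs p) /\
    (forall p, ~ both_complete p -> ~ labelled_pairs p -> exists n, C n p).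
Proof.
  intros HL.
  assert (HF : forall v : nat -> array, (forall n, finite_support (v n)) ->
     exists F : nat -> array -> Prop, (forall n, closed_in (meager_space L) (F n)) /\
       (forall j x, F j x -> forall m, v m <> x) /\
       (forall x, meager_space L x -> (forall m, v m <> x) -> exists j, F j x)).
  { intros v Hv.
    destruct (meager_space_countable_is_Gdelta L (fun x => exists n, v n = x) HL)
      as [F [F1 [F2 [F3 F4]]]].
    - exists v. auto.
    - intros x [n <-]. apply (finite_support_carrier L true); auto.
    - exists F. split; [|split]; auto.
      + intros j x Fx m E. apply (proj2 (F3 j x Fx)). eauto.
      + intros x Yx Hx. apply F4; auto. intros [m E]. exact (Hx m E). }
  destruct (HF labelled_fst labelled_fst_finite_support) as [F [F1 [F2 F3]]].
  destruct (HF labelled_snd labelled_snd_finite_support) as [G [G1 [G2 G3]]].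
  exists (fun n p => let (b, jk) := pairing n in let (j, k) := pairing jk in
    match b with
    | 0 => avoiding F labelled_fst labelled_snd j k (fst p) (snd p)
    | S _ => avoiding G labelled_snd labelled_fst j k (snd p) (fst p)
    end).
  split; [|split].
  - intros n p Hp. destruct (pairing n) as [b jk]. destruct (pairing jk) as [j k].
    destruct b.
    + destruct (avoiding_closed L F _ _ j k (fst p) (snd p) (F1 j) Hp) as [l Hl].
      exists l. intros q [Hq1 Hq2]. auto.
    + destruct (avoiding_closed L G _ _ j k (snd p) (fst p) (G1 j) Hp) as [l Hl].
      exists l. intros q [Hq1 Hq2]. auto.
  - intros n p. destruct (pairing n) as [b jk]. destruct (pairing jk) as [j k].
    intros HC [m [E1 E2]]. revert HC. destruct b.
    + now apply (avoiding_disjoint L F _ _ j k m _ _ labelled_fst_inj F2).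
    + now apply (avoiding_disjoint L G _ _ j k m _ _ labelled_snd_inj G2).
  - intros p Hp HD. destruct (side (fst p)) eqn:E1; [|destruct (side (snd p)) eqn:E2].
    + destruct (avoiding_cover L F labelled_fst labelled_snd (fst p) (snd p))
        as [j [k Hjk]]; auto.
      destruct (pairing_surj j k) as [jk Ejk]. destruct (pairing_surj 0 jk) as [n En].
      exists n. now rewrite En, Ejk.
    + destruct (avoiding_cover L G labelled_snd labelled_fst (snd p) (fst p))
        as [j [k Hjk]]; auto.
      { intros [n [H1 H2]]. apply HD. exists n. auto. }
      destruct (pairing_surj j k) as [jk Ejk]. destruct (pairing_surj 1 jk) as [n En].
      exists n. now rewrite En, Ejk.
    + exfalso. apply Hp. split; auto.
Qed.

Lemma bool_code (s : bool) : exists a, (a =? 0) = s.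
Proof. destruct s; [exists 0|exists 1]; reflexivity. Qed.

Lemma countable_pairs L (v w : nat -> array) :
  (forall n s, carrier L s (v n)) -> (forall n s, carrier L s (w n)) ->
  countable_set (fun p : space L * space L => exists n, arr (fst p) = v n /\ arr (snd p) = w n).
Proof.
  intros Hv Hw.
  (* The same two arrays give four points of the square; [a] and [b] code the sides. *)
  exists (fun c => let (a, u) := pairing c in let (b, n) := pairing u in
            (point (a =? 0) (v n) (Hv n _), point (b =? 0) (w n) (Hw n _))).
  intros [p q] [n [Ep Eq]]. simpl in *.
  destruct (bool_code (side p)) as [a Ea]. destruct (bool_code (side q)) as [b Eb].
  destruct (pairing_surj b n) as [u Eu]. destruct (pairing_surj a u) as [c Ec].
  exists c. rewrite Ec, Eu. f_equal; now apply space_eq.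
Qed.

Lemma labelled_pairs_countable L : lambda_family L -> countable_set (@labelled_pairs L).
Proof.
  intros HL. apply countable_pairs; intros n s; apply finite_support_carrier; auto.
  - apply labelled_fst_finite_support.
  - apply labelled_snd_finite_support.
Qed.

Lemma fin_pairs_countable L : lambda_family L -> countable_set (@fin_pairs L).
Proof.
  intros HL.
  destruct (countable_pairs L (fun n => fin (fst (pairing n))) (fun n => fin (snd (pairing n))))
    as [f Hf].
  - intros n s. apply finite_support_carrier; auto. apply fin_finite_support.
  - intros n s. apply finite_support_carrier; auto. apply fin_finite_support.
  - exists f. intros p [c [d [E1 E2]]]. apply Hf.
    destruct (pairing_surj c d) as [n En]. exists n. rewrite En. auto.
Qed.

Lemma fin_near L (p : space L) k : lambda_family L ->
  exists c q, near k p q /\ arr q = fin c.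
Proof.
  intros HL. destruct (fin_dense (arr p) k) as [c Hc].
  { apply (carrier_finite_rows L (side p)), arr_carrier. }
  exists c, (point (side p) (fin c) (finite_support_carrier L _ _ HL (fin_finite_support c))).
  split; [split|]; auto.
Qed.

Lemma labelled_pairs_dense L : lambda_family L -> dense (ball_topology pnear) (@labelled_pairs L).
Proof.
  intros HL. apply (ball_topology_dense _ _ (pnear_refining L)). intros [p q] k.
  destruct (fin_near L p k HL) as [i [p' [[Es Hp] Ep]]].
  destruct (fin_near L q k HL) as [j [q' [[Es' Hq] Eq]]].
  destruct (pairing_surj i j) as [ij Eij]. destruct (pairing_surj k ij) as [n En].
  exists (point (side p) _ (finite_support_carrier L _ _ HL (labelled_fst_finite_support n)),
          point (side q) _ (finite_support_carrier L _ _ HL (labelled_snd_finite_support n))).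
  split; [exists n; auto|]. split; (split; [reflexivity|]).
  - change (agree k (arr p) (labelled_fst n)). unfold labelled_fst. rewrite En, Eij.
    apply agree_trans with (fin i); [now rewrite <- Ep|apply labelled_agree].
  - change (agree k (arr q) (labelled_snd n)). unfold labelled_snd. rewrite En, Eij.
    apply agree_trans with (fin j); [now rewrite <- Eq|apply labelled_agree].
Qed.

Lemma fin_pairs_dense L : lambda_family L -> dense (ball_topology pnear) (@fin_pairs L).
Proof.
  intros HL. apply (ball_topology_dense _ _ (pnear_refining L)). intros [p q] k.
  destruct (fin_near L p k HL) as [i [p' [Hp Ep]]].
  destruct (fin_near L q k HL) as [j [q' [Hq Eq]]].
  exists (p', q'). split; [exists i, j; auto|split; auto].
Qed.

Lemma space_separable L : lambda_family L -> separable (ball_topology (@near L)).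
Proof.
  intros HL. exists (fun p => exists c, arr p = fin c). split.
  - exists (fun n => let (a, c) := pairing n in point (a =? 0) (fin c)
              (finite_support_carrier L _ _ HL (fin_finite_support c))).
    intros p [c Ec]. destruct (bool_code (side p)) as [a Ea].
    destruct (pairing_surj a c) as [n En]. exists n. rewrite En. now apply space_eq.
  - apply (ball_topology_dense _ _ (near_refining L)). intros p k.
    destruct (fin_near L p k HL) as [c [q [Hq Eq]]]. eauto.
Qed.

(* [labelled_pairs] is G_delta off the square of the complete side, whereas [fin_pairs] is
   dense in the Polish fibres over points of the meager side. *)
Lemma square_not_CDH L : lambda_family L ->
  ~ CDH (product_topology (ball_topology (@near L)) (ball_topology (@near L))).
Proof.
  intros HL Hcdh. rewrite product_topology_pnear in Hcdh.
  destruct (Hcdh labelled_pairs fin_pairs) as [h [[Hh [g [Hg [Hgh Hhg]]]] HAB]];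
    auto using labelled_pairs_countable, labelled_pairs_dense, fin_pairs_countable, fin_pairs_dense.
  destruct (labelled_pairs_Gdelta L HL) as [C [C1 [C2 C3]]].
  assert (Hfin : forall s c, carrier L s (fin c)).
  { intros s c. apply finite_support_carrier; auto. apply fin_finite_support. }
  set (y := point true (fin 0) (Hfin true 0)).
  (* The fibre over [y], a point of the meager side, is pulled back by the inverse of [h]; only the
     second coordinate of [q] matters. *)
  set (f := fun q : space L * space L => g (y, snd q)).
  assert (Hf : continuous (ball_topology pnear) (ball_topology pnear) f).
  { intros V HV q Vq. destruct (Hg V HV _ Vq) as [k Hk]. exists k.
    intros q' [_ Hq']. apply Hk. split; auto. apply (ref_refl _ (near_refining L)). }
  (* Each [q] is covered: if [f q] is not a labelled pair, it lies in some [C m]; if it is one, [h]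
     sends it to a pair in [fin_pairs], so [snd q] carries one of the countably many arrays
     [fin m]. *)
  destruct (baire_category L (fun n q => let (a, m) := pairing n in
      match a with 0 => C m (f q) | S _ => arr (snd q) = fin m end)
      (point false (fin 0) (Hfin false 0), point false (fin 0) (Hfin false 0)) 0)
    as [n [p [k [[_ [Es _]] Hp]]]].
  - intros n. destruct (pairing n) as [[|a] m].
    + exact (Hf _ (C1 m)).
    + intros q Hq. destruct (closed_in_singleton (fun _ => True) (fin m) (arr (snd q)) I Hq)
        as [k Hk]. exists k. intros q' [_ [_ Hq']] E. exact (Hk _ E Hq').
  - split; reflexivity.
  - intros q _. destruct (classic (labelled_pairs (f q))) as [HD|HD].
    + assert (Hfq : fin_pairs (y, snd q)).
      { apply HAB. exists (f q). split; auto. apply Hhg. }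
      destruct Hfq as [c [d [_ Ed]]]. simpl in Ed.
      destruct (pairing_surj 1 d) as [n En]. exists n. now rewrite En.
    + destruct (C3 (f q)) as [m Hm]; auto.
      (* Otherwise [h] would send [f q] to a point with first coordinate on the complete side, but
         that coordinate is [y]. *)
      { intros Hbc. assert (E := both_complete_preserved L h g (f q) HL Hh Hg Hgh Hhg Hbc).
        unfold f in E. rewrite Hhg in E. discriminate. }
      destruct (pairing_surj 0 m) as [n En]. exists n. now rewrite En.
  - simpl in Es. destruct (pairing n) as [[|a] m].
    (* The ball contains some [q] carrying a finitely supported array, and then [f] takes a labelled
       pair as value there, which [C m] excludes. *)
    + destruct (fin_near L (snd p) k HL) as [c [q [Hq Eq]]].
      apply (C2 m (f (fst p, q))).
      * apply (Hp (fst p, q)). split; auto. apply (ref_refl _ (near_refining L)).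
      * assert (Hfp : fin_pairs (y, q)) by (exists 0, c; auto).
        apply HAB in Hfp. destruct Hfp as [x [Dx Ex]].
        unfold f. simpl. rewrite <- Ex, Hgh. exact Dx.
    (* No ball consists of arrays equal to [fin m]: row [k] can be changed to have an entry 1 in
       column [N], outside the support of [fin m]. *)
    + destruct (fin_finite_support m) as [N HN].
      set (x := arr (snd p)).
      assert (Hx : carrier L false x).
      { assert (Hc := arr_carrier (snd p)). rewrite <- Es in Hc. exact Hc. }
      set (q := point false _ (carrier_row_extendable L false HL x k N Hx)).
      assert (Hq : arr q = fin m).
      { apply (Hp (fst p, q)). split; [apply (ref_refl _ (near_refining L))|].
        split; [exact (eq_sym Es)|]. apply agree_row_extend. }
      apply (f_equal (fun z => z k N)) in Hq. rewrite HN in Hq by auto.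
      unfold q, arr, point in Hq. simpl in Hq. rewrite !Nat.eqb_refl in Hq. discriminate.
Qed.

Theorem mainTheorem1 :
  MA_sigma_centered ->
  exists (X : Type) (T : topology X),
    is_topology T /\ metrizable T /\ separable T /\ zero_dimensional T /\
    CDH T /\ ~ CDH (product_topology T T).
Proof.
  intros _. destruct lambda_family_exists as [L HL].
  exists (space L), (ball_topology near). assert (HE := near_refining L).
  split; [now apply ball_topology_is_topology|].
  split; [now apply ball_topology_metrizable|].
  split; [now apply space_separable|].
  split; [now apply ball_topology_zero_dimensional|].
  split; [now apply space_CDH|now apply square_not_CDH].
Qed.
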